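(* For $t\in\mathbb D\setminus\{0\}$ let $$A_t:=\begin{pmatrix}0&0&0\\0&0&0\\0&0&t\end{pmatrix},\qquad \tilde A:=\begin{pmatrix}0&0&0\\0&0&1\\0&0&0\end{pmatrix}.$$ (i) For any $t\in\mathbb D\setminus\{0\}$ and any $B\in C'_{A_t}$ there is a holomorphic map $\varphi:\mathbb C\to\Omega_3$ with $\varphi(0)=A_t$ and $\varphi'(0)=B$. (ii) Let $B=(b_{ij})_{1\le i,j\le 3}\in C'_{\tilde A}$. Then there is a holomorphic map $\varphi:\mathbb C\to\Omega_3$ with $\varphi(0)=\tilde A$ and $\varphi'(0)=B$ if and only if $b_{11}=0$ or $b_{12}\neq b_{31}$. Otherwise, $k_{\Omega_3}(\tilde A;B)>0$.
   Context: $\mathbb D$ is the open unit disc in $\mathbb C$. $\mathcal M_n$ is the set of all $n\times n$ complex matrices (identified with $\mathbb C^{n^2}$) and $I\in\mathcal M_n$ the identity matrix. For $A\in\mathcal M_n$, $sp(A)$ is the spectrum (set of eigenvalues) of $A$ and $r(A)=\max_{\lambda\in sp(A)}|\lambda|$ its spectral radius. The spectral ball is $\Omega_n:=\{A\in\mathcal M_n: r(A)<1\}$. The Kobayashi--Royden pseudometric of $\Omega_n$ is $$k_{\Omega_n}(A;B):=\inf\{|\alpha|:\alpha\in\mathbb C\text{ and there is a holomorphic }\varphi:\mathbb D\to\Omega_n\text{ with }\varphi(0)=A,\ \alpha\varphi'(0)=B\}.$$ The functions $\sigma_j:\mathcal M_n\to\mathbb C$ are defined by $\det(tI-A)=t^n+\sum_{j=1}^n(-1)^j\sigma_j(A)t^{n-j}$.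 For a nonconstant function $g$ holomorphic near $A$, $g_A^*$ denotes the homogeneous polynomial of lowest nonzero degree in the Taylor expansion of $g$ at $A$, i.e. $g(X)-g(A)=g_A^*(X-A)+(\text{terms of higher order})$ with $g^*_A\not\equiv0$. Set $$C^\ast_A:=\{B\in\mathcal M_n:(\sigma_1)_A^*(B)=0,\dots,(\sigma_n)_A^*(B)=0\}.$$ For $\lambda\in\mathbb D$ let $\Phi_\lambda(X):=(X-\lambda I)(I-\overline{\lambda}X)^{-1}$, $X\in\Omega_n$ (an automorphism of $\Omega_n$), with differential $(\Phi_\lambda)_{\ast,A}:\mathcal M_n\to\mathcal M_n$ at $A$. Finally $$C'_A:=\bigcap_{\lambda\in sp(A)}(\Phi_\lambda)_{\ast,A}^{-1}\bigl(C^\ast_{\Phi_{\lambda}(A)}\bigr).$$ *)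

(* Defs.v *)
From HB Require Import structures.
From mathcomp Require Import all_boot all_order all_algebra.
From mathcomp Require Import all_classical all_reals all_analysis.
From mathcomp Require Import complex.

Set Implicit Arguments.
Unset Strict Implicit.
Unset Printing Implicit Defensive.

Import Order.TTheory GRing.Theory Num.Theory.
Import numFieldNormedType.Exports.

Local Open Scope classical_set_scope.
Local Open Scope ring_scope.

(* R[i] seen as a numFieldType, so that the canonical normed-module structures
   on a numFieldType K and on 'M[K]_n apply to it; in particular [derivable],
   [derive1] and ['d] below are complex derivatives. *)
Definition Cplx (R : realType) : numFieldType := R[i].

Section SpectralBall.
Variable R : realType.
Local Notation C := (Cplx R).

(* The real-valued modulus; [`|z|] itself lives in C. *)
Definition modulus (z : C) : R := Normc.normc z.

Definition disc : set C := [set z | `|z| < 1].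

(* Meant for an open set D; the values of f outside D play no role. *)
Definition holomorphic_map (V : normedModType C) (D : set C) (Om : set V)
    (f : C -> V) : Prop :=
  forall z, D z -> derivable f z 1 /\ Om (f z).

(* The set is bounded below, and nonempty whenever Om is open and contains A. *)
Definition kobayashi_royden (V : normedModType C) (Om : set V) (A B : V) : R :=
  inf [set modulus alpha | alpha in
        [set alpha : C | exists phi : C -> V,
          [/\ holomorphic_map disc Om phi,
              phi 0 = A & alpha *: derive1 phi 0 = B]]].

Variable n : nat.

Definition spectrum (A : 'M[C]_n) : set C := [set l | eigenvalue A l].

(* For n > 0 the set is finite and nonempty, so the supremum is a maximum. *)
Definition spectral_radius (A : 'M[C]_n) : R :=
  sup [set modulus l | l in spectrum A].

Definition spectral_ball : set 'M[C]_n := [set A | spectral_radius A < 1].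

Definition sigma (j : nat) (A : 'M[C]_n) : C :=
  (-1) ^+ j * (char_poly A)`_(n - j).

(* Homogeneous polynomials of degree m in the n * n matrix entries. A monomial
   is given by the list e of its m factors, so that a commutative monomial
   occurs once for each ordering of its factors and its coefficient is the sum
   of the corresponding c e. *)
Definition homogeneous_poly (m : nat) (P : 'M[C]_n -> C) : Prop :=
  exists c : {ffun 'I_m -> 'I_n * 'I_n} -> C, forall X,
    P X = \sum_(e : {ffun 'I_m -> 'I_n * 'I_n})
            c e * \prod_(k < m) X (e k).1 (e k).2.

Definition is_lowest_term (g : 'M[C]_n -> C) (A : 'M[C]_n)
    (P : 'M[C]_n -> C) : Prop :=
  exists m : nat,
    [/\ (0 < m)%N, homogeneous_poly m P, exists X, P X != 0 &
        (fun X => g X - g A - P (X - A)) =o_A (fun X => `|X - A| ^+ m)].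

(* A lowest term exists, and is unique, as soon as g is holomorphic near A and
   not constant there; the default value 0 is then irrelevant. *)
Definition lowest_term (g : 'M[C]_n -> C) (A : 'M[C]_n) : 'M[C]_n -> C :=
  xget (fun=> 0) [set P | is_lowest_term g A P].

Definition C_star (A : 'M[C]_n) : set 'M[C]_n :=
  [set B | forall j : nat, (1 <= j <= n)%N -> lowest_term (sigma j) A B = 0].

Definition Phi (lam : C) (X : 'M[C]_n) : 'M[C]_n :=
  (X - lam%:M) *m invmx (1%:M - (conjc lam : C) *: X).

Definition C_prime (A : 'M[C]_n) : set 'M[C]_n :=
  \bigcap_(lam in spectrum A) ('d (Phi lam) A @^-1` C_star (Phi lam A)).

End SpectralBall.

Arguments disc {R}.
Arguments spectral_ball {R n}.

(* Row and column indices in 'I_3 start at 0. *)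
Definition A_ (R : realType) (t : Cplx R) : 'M[Cplx R]_3 := t *: delta_mx 2 2.

Definition A_tilde (R : realType) : 'M[Cplx R]_3 := delta_mx 1 2.

(* Main.v *)
(* The eigenvalues of an entire curve in the spectral ball are bounded, hence
   constant.  Each entire curve below is a polynomial family N0 + z N1 with
   constant spectrum, conjugated by (1 + z M1)(1 + z M2) with M1^2 = M2^2 = 0;
   the conjugation produces any tangent vector of the conjugacy class of N0.

   Obstruction at A~ when b11 <> 0 and b12 = b31 = b32 = tr B = 0: for a disc
   phi through A~ with phi'(0) = D proportional to B, Cayley-Hamilton style
   elimination gives
     phi11^3 = sigma3(phi) - phi11 sigma2(phi) + O(z^4),
   while sigma2(phi) = O(z^2) and sigma3(phi) = O(z^3) are bounded by 3 and 1 on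
   the disc, so by Cauchy estimates they are at most 192 |z|^2 and 256 |z|^3 near
   0.  This forces |D11| <= 20, whence k(A~; B) >= |b11| / 20.

   The Cauchy estimates are proved for functions that are merely complex
   differentiable.  If f = o(z^(k-1)) and |f| <= M on the disc, Goursat's lemma
   on a square centred at w, with exceptional points 0 and w where the integrand
   is o(1/|z-p|), bounds the value at w of f / z^k by its supremum on the
   boundary of the square: this yields f = O(z^k) without any power series. *)
Require Import Defs.
From mathcomp Require Import all_boot all_order all_algebra.
From mathcomp Require Import all_classical all_reals all_analysis.
From mathcomp Require Import complex.
From mathcomp Require Import ring lra.

Import Order.TTheory GRing.Theory Num.Theory.
Import numFieldNormedType.Exports.

Set Implicit Arguments.
Unset Strict Implicit.
Unset Printing Implicit Defensive.

Local Open Scope classical_set_scope.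
Local Open Scope ring_scope.

(** At A~, membership of B in [C_prime] enters through tr B = 0, b32 = 0 and b12 b31 = 0. Hence b12
    = b31 means that both vanish, which explains the odd-looking dichotomy. Commutators with A~ move
    b13, b21, b23 freely and b22, b33 by opposite amounts, so N1 may have any entries n13, n21 and
    any n22, n33 of sum -b11. Nilpotency of A~ + z N1 then asks for n22 n33 = b11^2 + b12 n21 + b31
    n13. A nonzero b12 or b31 makes this solvable with n22 n33 = 0. If both vanish, then n22 n33 =
    b11^2, and det = 0 forces b11^3 = 0. The analytic bound turns this failure of one construction
    into an obstruction for every curve.

    Positivity of the metric needs one constant for all discs. The O-constants given by
    differentiability at 0 depend on phi; the Cauchy estimates replace them by constants that depend
    only on the bounds 3 and 1. The same bound disposes of entire curves: z -> phi(kz) is again a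
    disc, with derivative kB, and k is arbitrary. *)

Section Modulus.
Variable R : realType.
Local Notation C := (Cplx R).
Implicit Types (z w : C).

Lemma normcE_modulus z : `|z| = ((modulus z)%:C)%C.
Proof. by []. Qed.

Lemma modulus0 : modulus (0 : C) = 0.
Proof. exact: Normc.normc0. Qed.

Lemma modulus1 : modulus (1 : C) = 1.
Proof. exact: Normc.normc1. Qed.

Lemma modulusM z w : modulus (z * w) = modulus z * modulus w.
Proof. exact: Normc.normcM. Qed.

Lemma modulusV z : modulus z^-1 = (modulus z)^-1.
Proof. exact: Normc.normcV. Qed.

Lemma modulusX z k : modulus (z ^+ k) = modulus z ^+ k.
Proof.
by elim: k => [|k IH]; rewrite ?expr0 ?modulus1// !exprS modulusM IH.
Qed.

Lemma modulusD z w : modulus (z + w) <= modulus z + modulus w.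
Proof. exact: le_normcD. Qed.

Lemma modulusN z : modulus (- z) = modulus z.
Proof. exact: normcN. Qed.

Lemma modulusB z w : modulus (z - w) = modulus (w - z).
Proof. by rewrite -modulusN opprB. Qed.

Lemma modulus_ge0 z : 0 <= modulus z.
Proof. by case: z => a b; exact: sqrtr_ge0. Qed.

Lemma modulus_eq0 z : (modulus z == 0) = (z == 0).
Proof.
by apply/eqP/eqP => [/Normc.eq0_normc //|->]; rewrite modulus0.
Qed.

Lemma modulus_gt0 z : (0 < modulus z) = (z != 0).
Proof. by rewrite lt_neqAle modulus_ge0 andbT eq_sym modulus_eq0. Qed.

Lemma modulus_tri z w : modulus z - modulus w <= modulus (z + w).
Proof.
rewrite lerBlDr -(modulusN w).
by apply: le_trans (modulusD _ _); rewrite addrK.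
Qed.

Lemma modulus_Re_Im z : `|complex.Re z| <= modulus z /\ `|complex.Im z| <= modulus z.
Proof.
case: z => a b; rewrite /modulus /=; split.
  by rewrite -sqrtr_sqr ler_wsqrtr ?lerDl ?sqr_ge0.
by rewrite -sqrtr_sqr ler_wsqrtr ?lerDr ?sqr_ge0.
Qed.

Lemma modulus_le_Re_Im z : modulus z <= `|complex.Re z| + `|complex.Im z|.
Proof.
case: z => a b; rewrite /modulus /= -(ler_pXn2r (n := 2))// ?nnegrE ?sqrtr_ge0//.
  rewrite sqr_sqrtr ?addr_ge0 ?sqr_ge0// -[a ^+ 2]real_normK ?num_real//.
  rewrite -[b ^+ 2]real_normK ?num_real//.
  have := mulr_ge0 (normr_ge0 a) (normr_ge0 b); nra.
Qed.

End Modulus.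

(** * Integrals of complex-valued functions over real segments *)

Section SegmentIntegral.
Variable R : realType.
Local Notation C := (Cplx R).
Notation mu := (@lebesgue_measure R).
Implicit Types (g : R -> C) (a b c t : R).

(** Two-sided continuity, even at an end of the segment: a function that is continuous in the plane
    at each point of a side provides exactly this. *)
Definition contR (g : R -> C) (t : R) : Prop :=
  forall e : R, 0 < e -> exists2 d : R, 0 < d &
    forall t', `|t' - t| < d -> modulus (g t' - g t) < e.

Definition cont_on g a b := forall t, a <= t <= b -> contR g t.

Definition cint g a b : C :=
  Complex (\int[mu]_(t in `[a, b]) complex.Re (g t))
          (\int[mu]_(t in `[a, b]) complex.Im (g t)).

Lemma integrable_on (f : R -> R) a b :
  (forall t, a <= t <= b -> forall e : R, 0 < e -> exists2 d : R, 0 < d &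
    forall t', `|t' - t| < d -> `|f t' - f t| < e) ->
  mu.-integrable `[a, b] (EFin \o f).
Proof.
move=> H; apply: continuous_compact_integrable; first exact: segment_compact.
apply: continuous_in_subspaceT => t; rewrite inE/= in_itv/= => tab.
apply/cvgrPdist_lt => e e0; have [d d0 Hd] := H t tab e e0.
near=> s; rewrite distrC; apply: Hd.
near: s; apply/nbhs_ballP; exists d => // s; rewrite /ball/= => h.
by rewrite distrC.
Unshelve. all: by end_near. Qed.

Lemma integrable_Re g a b : cont_on g a b ->
  mu.-integrable `[a, b] (EFin \o (fun t => complex.Re (g t))).
Proof.
move=> cg; apply: integrable_on => t tab e e0; have [d d0 Hd] := cg t tab e e0.
exists d => // s /Hd; apply: le_lt_trans.
by have [+ _] := modulus_Re_Im (g s - g t); case: (g s) (g t) => ? ? [].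
Qed.

Lemma integrable_Im g a b : cont_on g a b ->
  mu.-integrable `[a, b] (EFin \o (fun t => complex.Im (g t))).
Proof.
move=> cg; apply: integrable_on => t tab e e0; have [d d0 Hd] := cg t tab e e0.
exists d => // s /Hd; apply: le_lt_trans.
by have [_ +] := modulus_Re_Im (g s - g t); case: (g s) (g t) => ? ? [].
Qed.

Lemma eq_cint g1 g2 a b : (forall t, a <= t <= b -> g1 t = g2 t) ->
  cint g1 a b = cint g2 a b.
Proof.
move=> H; rewrite /cint; congr (Complex _ _); apply: eq_Rintegral => t;
by rewrite inE/= in_itv/= => /H ->.
Qed.

Lemma cintD g1 g2 a b : cont_on g1 a b -> cont_on g2 a b ->
  cint (fun t => g1 t + g2 t) a b = cint g1 a b + cint g2 a b.
Proof.
move=> c1 c2; rewrite /cint.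
transitivity (Complex (\int[mu]_(t in `[a, b]) (complex.Re (g1 t) + complex.Re (g2 t)))
  (\int[mu]_(t in `[a, b]) (complex.Im (g1 t) + complex.Im (g2 t)))).
  congr (Complex _ _); apply: eq_Rintegral => t _;
  by case: (g1 t) (g2 t) => ? ? [].
by rewrite !RintegralD//=; do ?[exact: integrable_Re|exact: integrable_Im].
Qed.

Lemma cintZ g k a b : cont_on g a b ->
  cint (fun t => k * g t) a b = k * cint g a b.
Proof.
move=> cg; have iR := integrable_Re cg; have iI := integrable_Im cg.
case: k => x y; rewrite /cint.
transitivity (Complex
  (\int[mu]_(t in `[a, b]) (x * complex.Re (g t) - y * complex.Im (g t)))
  (\int[mu]_(t in `[a, b]) (x * complex.Im (g t) + y * complex.Re (g t)))).
  congr (Complex _ _); apply: eq_Rintegral => t _; by case: (g t).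
have iZ (f : R -> R) (r : R) : mu.-integrable `[a, b] (EFin \o f) ->
    mu.-integrable `[a, b] (EFin \o (fun t => r * f t)).
  by move=> i; exact: (integrableZl _ r i).
by rewrite RintegralB ?RintegralD ?RintegralZl//; exact: iZ.
Qed.

Lemma cint_split g a c b : cont_on g a b -> a <= c -> c <= b ->
  cint g a b = cint g a c + cint g c b.
Proof.
move=> cg ac cb; have iR := integrable_Re cg; have iI := integrable_Im cg.
rewrite /cint.
have key (f : R -> R) : mu.-integrable `[a, b] (EFin \o f) ->
    \int[mu]_(t in `[a, b]) f t =
    \int[mu]_(t in `[a, c]) f t + \int[mu]_(t in `[c, b]) f t.
  move=> i; have := @Rintegral_itvB R f (BLeft a) (BRight b) c i.
  rewrite !bnd_simp => /(_ ac cb).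
  rewrite Rintegral_itv_obnd_cbnd; last first.
    by apply: integrableS i => //; apply: subset_itvr; rewrite bnd_simp.
  by move=> <-; rewrite addrC subrK.
by rewrite (key _ iR) (key _ iI).
Qed.

Lemma Rintegral_cst_itv (r a b : R) : a <= b ->
  \int[mu]_(t in `[a, b]) r = r * (b - a).
Proof.
move=> ab; rewrite Rintegral_cst//= lebesgue_measure_itv/= lte_fin.
by move: ab; rewrite le_eqVlt => /predU1P[->|->] //; rewrite ltxx subrr.
Qed.

Lemma cint_cst k a b : a <= b -> cint (fun=> k) a b = ((b - a)%:C)%C * k.
Proof.
move=> ab; rewrite /cint !Rintegral_cst_itv//; case: k => x y /=.
rewrite [RHS](_ : _ = Complex ((b - a) * x - 0 * y) ((b - a) * y + 0 * x))//.
by rewrite !mul0r subr0 addr0 ![_ * (b - a)]mulrC.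
Qed.

(** The factor 2 comes from bounding the real and imaginary parts separately; it is the source of
    the 4 in [modulus_rect_int]. *)
Lemma modulus_cint g a b M : a <= b -> cont_on g a b ->
  (forall t, a <= t <= b -> modulus (g t) <= M) ->
  modulus (cint g a b) <= 2 * M * (b - a).
Proof.
move=> ab cg gM; have iR := integrable_Re cg; have iI := integrable_Im cg.
apply: le_trans (modulus_le_Re_Im _) _ => /=.
have key (f : R -> R) : mu.-integrable `[a, b] (EFin \o f) ->
   (forall t, a <= t <= b -> `|f t| <= M) ->
   `|\int[mu]_(t in `[a, b]) f t| <= M * (b - a).
  move=> i fM; apply: le_trans (le_normr_Rintegral _ i) _ => //.
  apply: (@le_trans _ _ (\int[mu]_(t in `[a, b]) (cst M t))).
    apply: le_Rintegral => //.
    - exact: integrable_norm i.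
    - apply: continuous_compact_integrable; first exact: segment_compact.
      by apply: continuous_subspaceT => ?; exact: cvg_cst.
  by rewrite Rintegral_cst_itv.
have kR := key _ iR; have kI := key _ iI.
rewrite -mulrA [2 * _](_ : _ = M * (b - a) + M * (b - a)); last by ring.
apply: lerD; [apply: kR|apply: kI] => t /gM; apply: le_trans;
  by have [] := modulus_Re_Im (g t).
Qed.

(** Serves to keep the integral of 1/z around the origin away from 0 without computing it. *)
Lemma Im_cint_ge g a b m : a <= b -> cont_on g a b ->
  (forall t, a <= t <= b -> m <= complex.Im (g t)) ->
  m * (b - a) <= complex.Im (cint g a b).
Proof.
move=> ab cg gm /=; have iI := integrable_Im cg.
apply: (@le_trans _ _ (\int[mu]_(t in `[a, b]) (cst m t))).
  by rewrite Rintegral_cst_itv.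
apply: le_Rintegral => //.
apply: continuous_compact_integrable; first exact: segment_compact.
by apply: continuous_subspaceT => ?; exact: cvg_cst.
Qed.

End SegmentIntegral.

(** * Complex derivatives with real radii and real error terms *)

Section ComplexDerivative.
Variable R : realType.
Local Notation C := (Cplx R).

(** The order on [C] is partial and its positive elements are real, so the epsilon-delta statement
    over [C] can be restated with a real radius and a real error. *)
Lemma derivable_expand (V : normedModType C) (f : C -> V) (z : C) :
  derivable f z 1 -> forall e : R, 0 < e -> exists2 d : R, 0 < d &
    forall z', modulus (z' - z) < d ->
    `|f z' - f z - (z' - z) *: derive1 f z| <= ((e * modulus (z' - z))%:C)%C.
Proof.
move=> df e e0; rewrite derive1E.
have e0C : 0 < (e%:C)%C :> C by rewrite ltcR.
have /cvgrPdist_le/(_ _ e0C) : h^-1 *: (f (h *: 1 + z) - f z) @[h --> 0^'] --> 'D_1 f z.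
  exact: df.
case=> /= d d0 H; exists (complex.Re d).
  by move: d0; rewrite ltcE => /andP[].
move=> z' zd; have [->|nz] := eqVneq z' z.
  by rewrite !subrr scale0r subr0 normr0 modulus0 mulr0.
have nz' : z' - z != 0 by rewrite subr_eq0.
have dE : d = ((complex.Re d)%:C)%C.
  by case: d d0 {H zd} => x y; rewrite ltcE /= => /andP[/eqP -> _].
have := H (z' - z); rewrite /ball_ /= sub0r normrN dE normcE_modulus ltcR.
move=> /(_ zd nz'); rewrite scaler1 subrK => K.
have -> : f z' - f z - (z' - z) *: 'D_1 f z =
   - ((z' - z) *: ('D_1 f z - (z' - z)^-1 *: (f z' - f z))).
  by rewrite scalerBr scalerA divff// scale1r opprB.
rewrite normrN normrZ rmorphM/= mulrC -normcE_modulus.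
by apply: ler_wpM2r => //; exact: K.
Qed.

Lemma expand_derivable (V : normedModType C) (f : C -> V) (z : C) (L : V) :
  (forall e : R, 0 < e -> exists2 d : R, 0 < d &
    forall z', modulus (z' - z) < d ->
    `|f z' - f z - (z' - z) *: L| <= ((e * modulus (z' - z))%:C)%C) ->
  derivable f z 1 /\ derive1 f z = L.
Proof.
move=> H.
have K : h^-1 *: (f (h *: 1 + z) - f z) @[h --> (0 : C)^'] --> L.
  apply/cvgrPdist_le => e e0.
  have eE : e = ((complex.Re e)%:C)%C.
    by case: e e0 => x y; rewrite ltcE /= => /andP[/eqP -> _].
  have e0' : 0 < complex.Re e by move: e0; rewrite ltcE => /andP[].
  have [d d0 Hd] := H _ e0'.
  exists (d%:C)%C => /=; first by rewrite ltcR.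
  move=> h; rewrite /ball_ /= sub0r normrN normcE_modulus ltcR => hd h0.
  have := Hd (h + z); rewrite addrK => /(_ hd); rewrite scaler1.
  rewrite rmorphM/= -normcE_modulus -eE => Q.
  have -> : L - h^-1 *: (f (h + z) - f z) =
      - (h^-1 *: (f (h + z) - f z - h *: L)).
    by rewrite [in RHS]scalerBr scalerA mulVf// scale1r opprB.
  rewrite normrN normrZ normfV mulrC ler_pdivrMr ?normr_gt0//.
split; first by apply/cvg_ex; exists L.
by rewrite derive1E; apply: cvg_lim.
Qed.

Implicit Types (h f g : C -> C) (z w : C).

Lemma holo_cst (k : C) z : derivable ((fun=> k) : C -> C) z 1.
Proof. exact: derivable_cst. Qed.

Lemma holo_id z : derivable ((fun x => x) : C -> C) z 1.
Proof. exact: derivable_id. Qed.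

Lemma holoD f g z : derivable f z 1 -> derivable g z 1 ->
  derivable (fun x => f x + g x) z 1.
Proof. by move=> df dg; exact: (derivableD df dg). Qed.

Lemma derive1_add f g z : derivable f z 1 -> derivable g z 1 ->
  derive1 (fun x => f x + g x) z = derive1 f z + derive1 g z.
Proof. by move=> df dg; rewrite !derive1E; exact: (deriveD df dg). Qed.

Lemma derive1_mul f g z : derivable f z 1 -> derivable g z 1 ->
  derive1 (fun x => f x * g x) z = f z * derive1 g z + g z * derive1 f z.
Proof. by move=> df dg; rewrite !derive1E; exact: (deriveM df dg). Qed.

Lemma holoB f g z : derivable f z 1 -> derivable g z 1 ->
  derivable (fun x => f x - g x) z 1.
Proof. by move=> df dg; exact: (derivableB df dg). Qed.

Lemma holoM f g z : derivable f z 1 -> derivable g z 1 ->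
  derivable (fun x => f x * g x) z 1.
Proof. by move=> df dg; exact: (derivableM df dg). Qed.

Lemma holoV f z : f z != 0 -> derivable f z 1 ->
  derivable (fun x => (f x)^-1) z 1.
Proof. by move=> fz df; exact: (derivableV fz df). Qed.

Lemma holoX f k z : derivable f z 1 -> derivable (fun x => f x ^+ k) z 1.
Proof.
move=> df; elim: k => [|k IH]; first exact: holo_cst.
by under eq_fun do rewrite exprS; exact: (derivableM df IH).
Qed.

Lemma derivable_modulus h z : derivable h z 1 ->
  forall e : R, 0 < e -> exists2 d : R, 0 < d &
    forall z', modulus (z' - z) < d ->
    modulus (h z' - h z - (z' - z) * derive1 h z) <= e * modulus (z' - z).
Proof.
move=> dh e e0; have [d d0 H] := derivable_expand dh e0.
by exists d => // z' /H; rewrite normcE_modulus lecR.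
Qed.

Definition ccont h z := forall e : R, 0 < e -> exists2 d : R, 0 < d &
    forall z', modulus (z' - z) < d -> modulus (h z' - h z) < e.

Lemma derivable_ccont h z : derivable h z 1 -> ccont h z.
Proof.
move=> dh e e0; have [d d0 H] := derivable_modulus dh ltr01.
set c := modulus (derive1 h z).
have c1 : 0 < 1 + c by rewrite ltr_pwDl// modulus_ge0.
exists (Num.min d (e / (1 + c))); first by rewrite lt_min d0 divr_gt0.
move=> z'; rewrite lt_min => /andP[/H {}H]; rewrite ltr_pdivlMr// => K.
apply: le_lt_trans K.
rewrite -(subrK ((z' - z) * derive1 h z) (h z' - h z)).
apply: le_trans (modulusD _ _) _; rewrite modulusM.
by apply: le_trans (lerD H (lexx _)) _; rewrite mul1r mulrDr mulr1.
Qed.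

(** Used to centre a square at a point ([k = 1]) and to rescale a disc ([w = 0]). Dividing by
    [1 + modulus k] treats [k = 0] along with the rest. *)
Lemma derivable_comp_affine (V : normedModType C) (f : C -> V) (k w z : C) :
  derivable f (k * z + w) 1 -> derivable (fun x => f (k * x + w)) z 1 /\
  derive1 (fun x => f (k * x + w)) z = k *: derive1 f (k * z + w).
Proof.
move=> df; apply: expand_derivable => e e0.
have k0 : 0 < 1 + modulus k by rewrite ltr_pwDl// modulus_ge0.
have [d d0 H] := derivable_expand df (divr_gt0 e0 k0).
exists (d / (1 + modulus k)); first exact: divr_gt0.
move=> z'; rewrite ltr_pdivlMr// => zd.
have E : k * z' + w - (k * z + w) = (z' - z) * k by ring.
have Kd : modulus ((z' - z) * k) <= modulus (z' - z) * (1 + modulus k).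
  by rewrite modulusM ler_wpM2l ?modulus_ge0// lerDr.
have := H (k * z' + w); rewrite E -scalerA => /(_ (le_lt_trans Kd zd)).
move=> /le_trans; apply; rewrite lecR -mulrA ler_pM2l// mulrC ler_pdivrMr//.
Qed.

End ComplexDerivative.

(** * Goursat's lemma on rectangles *)

Local Arguments modulus : simpl never.

Section Goursat.
Variable R : realType.
Local Notation C := (Cplx R).
Implicit Types (h g : C -> C) (a b c d x y m l : R).

Definition pt (x y : R) : C := Complex x y.

Lemma modulus_pt_le x y : modulus (pt x y) <= `|x| + `|y|.
Proof. exact: modulus_le_Re_Im. Qed.

Lemma ptB x y x' y' : pt x y - pt x' y' = pt (x - x') (y - y').
Proof. by []. Qed.

Definition contH h a b y := forall x, a <= x <= b -> ccont h (pt x y).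
Definition contV h x c d := forall y, c <= y <= d -> ccont h (pt x y).

Lemma contH_on h a b y : contH h a b y -> cont_on (fun x => h (pt x y)) a b.
Proof.
move=> ch x xab e e0; have [d d0 H] := ch x xab e e0.
exists d => // x' xd; apply: H; rewrite ptB subrr.
by apply: le_lt_trans (modulus_pt_le _ _) _; rewrite normr0 addr0.
Qed.

Lemma contV_on h x c d : contV h x c d -> cont_on (fun y => h (pt x y)) c d.
Proof.
move=> ch y yab e e0; have [d' d0 H] := ch y yab e e0.
exists d' => // y' yd; apply: H; rewrite ptB subrr.
by apply: le_lt_trans (modulus_pt_le _ _) _; rewrite normr0 add0r.
Qed.

(* The contour integral of [h] along the boundary of [a, b] x [c, d]. *)
Definition rect_int h a b c d : C :=
  cint (fun x => h (pt x c)) a b - cint (fun x => h (pt x d)) a b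
  + pt 0 1 * (cint (fun y => h (pt b y)) c d - cint (fun y => h (pt a y)) c d).

Definition cont_bd h a b c d :=
  [/\ contH h a b c, contH h a b d, contV h a c d & contV h b c d].

Lemma rect_intV h a m b c d : contH h a b c -> contH h a b d ->
  a <= m -> m <= b ->
  rect_int h a b c d = rect_int h a m c d + rect_int h m b c d.
Proof.
move=> /contH_on hc /contH_on hd am mb; rewrite /rect_int.
by rewrite (cint_split hc am mb) (cint_split hd am mb); ring.
Qed.

Lemma rect_intH h a b c m d : contV h a c d -> contV h b c d ->
  c <= m -> m <= d ->
  rect_int h a b c d = rect_int h a b c m + rect_int h a b m d.
Proof.
move=> /contV_on ha /contV_on hb cm md; rewrite /rect_int.
by rewrite (cint_split ha cm md) (cint_split hb cm md); ring.
Qed.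

Lemma rect_intD h g a b c d : cont_bd h a b c d -> cont_bd g a b c d ->
  rect_int (fun z => h z + g z) a b c d = rect_int h a b c d + rect_int g a b c d.
Proof.
move=> [/contH_on h1 /contH_on h2 /contV_on h3 /contV_on h4].
move=> [/contH_on g1 /contH_on g2 /contV_on g3 /contV_on g4].
by rewrite /rect_int !cintD//; ring.
Qed.

Lemma rect_intZ h k a b c d : cont_bd h a b c d ->
  rect_int (fun z => k * h z) a b c d = k * rect_int h a b c d.
Proof.
move=> [/contH_on h1 /contH_on h2 /contV_on h3 /contV_on h4].
by rewrite /rect_int !cintZ//; ring.
Qed.

Arguments rect_int : simpl never.

Definition on_bd a b c d (z : C) :=
  a <= complex.Re z <= b /\ c <= complex.Im z <= d /\
  [|| complex.Re z == a, complex.Re z == b, complex.Im z == c | complex.Im z == d].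

Lemma on_bd_pt a b c d (P : C -> Prop) : a <= b -> c <= d ->
  (forall z, on_bd a b c d z -> P z) ->
  [/\ forall x, a <= x <= b -> P (pt x c), forall x, a <= x <= b -> P (pt x d),
      forall y, c <= y <= d -> P (pt a y) & forall y, c <= y <= d -> P (pt b y)].
Proof.
by move=> ab cd H; split=> t tI; apply: H; rewrite /on_bd /= tI ?ab ?cd ?lexx ?eqxx ?orbT.
Qed.

Lemma cont_bdP h a b c d : a <= b -> c <= d ->
  (forall z, on_bd a b c d z -> ccont h z) -> cont_bd h a b c d.
Proof. by move=> ab cd /(on_bd_pt ab cd). Qed.

Lemma eq_rect_int h g a b c d : a <= b -> c <= d ->
  (forall z, on_bd a b c d z -> h z = g z) ->
  rect_int h a b c d = rect_int g a b c d.
Proof.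
move=> ab cd /(on_bd_pt ab cd) [h1 h2 h3 h4].
by rewrite /rect_int (eq_cint h1) (eq_cint h2) (eq_cint h3) (eq_cint h4).
Qed.

Lemma modulus_rect_int h a b c d M : a <= b -> c <= d -> cont_bd h a b c d ->
  (forall z, on_bd a b c d z -> modulus (h z) <= M) ->
  modulus (rect_int h a b c d) <= 4 * M * ((b - a) + (d - c)).
Proof.
move=> ab cd [/contH_on h1 /contH_on h2 /contV_on h3 /contV_on h4].
move=> /(on_bd_pt ab cd) [b1 b2 b3 b4]; rewrite /rect_int.
apply: le_trans (modulusD _ _) _.
rewrite modulusM [modulus (pt 0 1)](_ : _ = 1) ?mul1r; last first.
  by rewrite /modulus /= expr0n add0r expr1n sqrtr1.
have k1 := modulus_cint ab h1 b1; have k2 := modulus_cint ab h2 b2.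
have k3 := modulus_cint cd h3 b3; have k4 := modulus_cint cd h4 b4.
apply: le_trans (lerD (modulusD _ _) (modulusD _ _)) _.
rewrite !modulusN; lra.
Qed.

(** On opposite sides an affine function differs by a constant. The two differences integrate to k1
    i (c - d)(b - a) and i k1 (b - a)(d - c), which cancel; no primitive is involved. *)
Lemma rect_int_affine (k0 k1 : C) a b c d : a <= b -> c <= d ->
  rect_int (fun z => k0 + k1 * z) a b c d = 0.
Proof.
move=> ab cd.
have aff t : derivable ((fun z => k0 + k1 * z) : C -> C) t 1.
  by apply: holoD; [exact: holo_cst|apply: holoM; [exact: holo_cst|exact: holo_id]].
have ct t : ccont (fun z => k0 + k1 * z) t by exact: derivable_ccont (aff t).
have cH y : cont_on (fun x => k0 + k1 * pt x y) a b.
  by apply: (@contH_on (fun z => k0 + k1 * z)) => t _; exact: ct.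
have cV x : cont_on (fun y => k0 + k1 * pt x y) c d.
  by apply: (@contV_on (fun z => k0 + k1 * z)) => t _; exact: ct.
have cc (k : C) u v : cont_on (fun=> k) u v.
  by move=> t _ e e0; exists 1 => // ? _; rewrite subrr modulus0.
have e1 : cint (fun x => k0 + k1 * pt x c) a b =
    cint (fun x => k0 + k1 * pt x d) a b + (b - a)%:C%C * (k1 * pt 0 (c - d)).
  rewrite -cint_cst// -cintD//; apply: eq_cint => x _ /=.
  have -> : pt x c = pt x d + pt 0 (c - d) by rewrite /pt; congr Complex => /=; ring.
  by ring.
have e2 : cint (fun y => k0 + k1 * pt b y) c d =
    cint (fun y => k0 + k1 * pt a y) c d + (d - c)%:C%C * (k1 * pt (b - a) 0).
  rewrite -cint_cst// -cintD//; apply: eq_cint => x _ /=.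
  have -> : pt b x = pt a x + pt (b - a) 0 by rewrite /pt; congr Complex => /=; ring.
  by ring.
rewrite /rect_int e1 e2 [X in X - _]addrC addrK [X in _ * (X - _)]addrC addrK.
have -> : pt 0 (c - d) = - (d - c)%:C%C * pt 0 1.
  by rewrite /pt; congr Complex => /=; ring.
have -> : pt (b - a) 0 = (b - a)%:C%C by [].
ring.
Qed.

(** Every right end bounds all left ends, so the supremum of the left ends lies in each interval. *)
Lemma nested_point (u r : nat -> R) :
  (forall n, u n <= u n.+1) -> (forall n, u n.+1 + r n.+1 <= u n + r n) ->
  (forall n, 0 <= r n) -> exists p, forall n, u n <= p <= u n + r n.
Proof.
move=> uS rS r0.
have mono n k : u n <= u (n + k)%N.
  by elim: k => [|k IH]; rewrite ?addn0// addnS (le_trans IH).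
have monor n k : u (n + k)%N + r (n + k)%N <= u n + r n.
  by elim: k => [|k IH]; rewrite ?addn0// addnS (le_trans _ IH).
have ub n k : u k <= u n + r n.
  have [nk|/ltnW kn] := leqP n k.
    rewrite -(subnKC nk); apply: le_trans (monor n (k - n)%N).
    by rewrite lerDl.
  rewrite -(subnKC kn); apply: le_trans (mono k (n - k)%N) _.
  by rewrite lerDl.
exists (sup (range u)) => n; apply/andP; split.
  apply: ub_le_sup; last by exists n.
  by exists (u 0 + r 0) => _ [k _ <-].
by apply: ge_sup; [exists (u 0); exists 0|move=> _ [k _ <-]].
Qed.

(** The integrals over the four pieces add up to the whole, so one piece carries at least a quarter
    of the modulus. *)
Lemma quadrisect h x x1 x2 y y1 y2 :
  x <= x1 -> x1 <= x2 -> y <= y1 -> y1 <= y2 ->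
  (forall u v, x <= u <= x2 -> y <= v <= y2 -> derivable h (pt u v) 1) ->
  forall K : R, 4 * K <= modulus (rect_int h x x2 y y2) ->
  [\/ K <= modulus (rect_int h x x1 y y1), K <= modulus (rect_int h x x1 y1 y2),
      K <= modulus (rect_int h x1 x2 y y1) | K <= modulus (rect_int h x1 x2 y1 y2)].
Proof.
move=> E1 E2 F1 F2 dh K.
have ch u v : x <= u <= x2 -> y <= v <= y2 -> ccont h (pt u v).
  by move=> ? ?; apply: derivable_ccont; exact: dh.
have cH u v k : x <= u -> v <= x2 -> y <= k <= y2 -> contH h u v k.
  by move=> ? ? ? t /andP[? ?]; apply: ch => //; apply/andP; split; lra.
have cV u v k : y <= u -> v <= y2 -> x <= k <= x2 -> contV h k u v.
  by move=> ? ? ? t /andP[? ?]; apply: ch => //; apply/andP; split; lra.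
have y02 : y <= y2 by exact: le_trans F1 F2.
have x02 : x <= x2 by exact: le_trans E1 E2.
have i0 : x <= x <= x2 by rewrite lexx.
have i1 : x <= x1 <= x2 by rewrite E1.
have i2 : x <= x2 <= x2 by rewrite lexx x02.
have j0 : y <= y <= y2 by rewrite lexx.
have j2 : y <= y2 <= y2 by rewrite lexx y02.
rewrite (rect_intV (m := x1)) //; try by apply: cH.
rewrite (rect_intH (a := x) (m := y1)) //; try by apply: cV.
rewrite (rect_intH (a := x1) (m := y1)) //; try by apply: cV.
move: (rect_int h x x1 y y1) (rect_int h x x1 y1 y2) (rect_int h x1 x2 y y1)
  (rect_int h x1 x2 y1 y2) => J1 J2 J3 J4 H.
have := le_trans H (le_trans (modulusD _ _) (lerD (modulusD _ _) (modulusD _ _))).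
move=> {}H; have [?|K1] := leP K (modulus J1); first by apply: Or41.
have [?|K2] := leP K (modulus J2); first by apply: Or42.
have [?|K3] := leP K (modulus J3); first by apply: Or43.
have [?|K4] := leP K (modulus J4); first by apply: Or44.
exfalso; lra.
Qed.

(** Subtracting the affine Taylor part at [pt p q] leaves the integral unchanged and bounds the
    integrand by e times the half-perimeter; the length of the boundary supplies the second
    factor. *)
Lemma rect_int_small h x0 x1 y0 y1 p q e dd : x0 <= p <= x1 -> y0 <= q <= y1 ->
  (forall u v, x0 <= u <= x1 -> y0 <= v <= y1 -> derivable h (pt u v) 1) ->
  (forall z, modulus (z - pt p q) < dd ->
    modulus (h z - h (pt p q) - (z - pt p q) * derive1 h (pt p q)) <=
      e * modulus (z - pt p q)) ->
  0 <= e -> (x1 - x0) + (y1 - y0) < dd ->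
  modulus (rect_int h x0 x1 y0 y1) <= 4 * e * ((x1 - x0) + (y1 - y0)) ^+ 2.
Proof.
move=> /andP[px0 px1] /andP[qy0 qy1] dh Hd e0 ld.
have x01 : x0 <= x1 by exact: le_trans px1.
have y01 : y0 <= y1 by exact: le_trans qy1.
set D := derive1 h (pt p q) in Hd.
pose aff (z : C) := (h (pt p q) - pt p q * D) + D * z.
have daff z : derivable (aff : C -> C) z 1.
  by apply: holoD; [exact: holo_cst|apply: holoM; [exact: holo_cst|exact: holo_id]].
have bdin z : on_bd x0 x1 y0 y1 z -> derivable h z 1.
  by case: z => u v [/= ? [? _]]; exact: dh.
have c1 : cont_bd aff x0 x1 y0 y1.
  by apply: cont_bdP => // z _; exact: derivable_ccont.
have c2 : cont_bd (fun z => h z - aff z) x0 x1 y0 y1.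
  apply: cont_bdP => // z /bdin hz; apply: derivable_ccont.
  by apply: holoB; [exact: hz|exact: daff].
have -> : rect_int h x0 x1 y0 y1 = rect_int (fun z => h z - aff z) x0 x1 y0 y1.
  have -> : rect_int h x0 x1 y0 y1 =
     rect_int (fun z => aff z + (h z - aff z)) x0 x1 y0 y1.
    by apply: eq_rect_int => // z _; rewrite addrC subrK.
  by rewrite rect_intD// rect_int_affine// add0r.
rewrite expr2 mulrA -mulrA mulrA -[4 * e * _]mulrA.
apply: modulus_rect_int => // -[u v] [/= /andP[? ?] [/andP[? ?] _]].
have zd : modulus (pt u v - pt p q) <= (x1 - x0) + (y1 - y0).
  rewrite ptB; apply: le_trans (modulus_pt_le _ _) _.
  by apply: lerD; rewrite ler_norml; apply/andP; split; lra.
have -> : h (pt u v) - aff (pt u v) =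
    h (pt u v) - h (pt p q) - (pt u v - pt p q) * D by rewrite /aff; ring.
apply: le_trans (Hd _ (le_lt_trans zd ld)) _.
exact: ler_wpM2l.
Qed.

Lemma goursat h a b c d : a <= b -> c <= d ->
  (forall x y, a <= x <= b -> c <= y <= d -> derivable h (pt x y) 1) ->
  rect_int h a b c d = 0.
Proof.
move=> ab cd dh; apply/eqP; rewrite -modulus_eq0; apply/negPn/negP => J0.
set N := modulus (rect_int h a b c d) in J0.
have N0 : 0 < N by rewrite lt_neqAle eq_sym J0 modulus_ge0.
set l := b - a; set m := d - c.
have l0 : 0 <= l by rewrite subr_ge0.
have m0 : 0 <= m by rewrite subr_ge0.
pose s n : R := 2^-1 ^+ n.
have s0 n : 0 < s n by rewrite exprn_gt0// invr_gt0.
have sS n : s n = s n.+1 + s n.+1 by rewrite /s exprS; field.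
(* The copy of the rectangle scaled by [2^-n] with lower left corner [q] still carries at least the
   fraction [4^-n] of the integral. *)
pose bad n (q : R * R) := [/\ a <= q.1, q.1 + l * s n <= b, c <= q.2,
  q.2 + m * s n <= d & N * s n ^+ 2 <=
    modulus (rect_int h q.1 (q.1 + l * s n) q.2 (q.2 + m * s n))].
have step n q : bad n q -> exists q', [/\ bad n.+1 q', q.1 <= q'.1,
   q'.1 + l * s n.+1 <= q.1 + l * s n, q.2 <= q'.2 &
   q'.2 + m * s n.+1 <= q.2 + m * s n].
  case: q => x y [/= ax xb cy yd].
  have ls : 0 <= l * s n.+1 by rewrite mulr_ge0// ltW.
  have ms : 0 <= m * s n.+1 by rewrite mulr_ge0// ltW.
  move: xb yd; rewrite sS !mulrDr !addrA => xb yd H.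
  have E1 : x <= x + l * s n.+1 by rewrite lerDl.
  have E2 : x + l * s n.+1 <= x + l * s n.+1 + l * s n.+1 by rewrite lerDl.
  have F1 : y <= y + m * s n.+1 by rewrite lerDl.
  have F2 : y + m * s n.+1 <= y + m * s n.+1 + m * s n.+1 by rewrite lerDl.
  have dxy u v : x <= u <= x + l * s n.+1 + l * s n.+1 ->
      y <= v <= y + m * s n.+1 + m * s n.+1 -> derivable h (pt u v) 1.
    move=> /andP[u1 u2] /andP[v1 v2]; apply: dh; apply/andP; split.
    - exact: le_trans ax u1.
    - exact: le_trans u2 xb.
    - exact: le_trans cy v1.
    - exact: le_trans v2 yd.
  have [] := quadrisect (K := N * s n.+1 ^+ 2) E1 E2 F1 F2 dxy.
  - by apply: le_trans H; rewrite le_eqVlt; apply/orP; left; apply/eqP; ring.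
  - move=> K; exists (x, y); split=> //=; split=> //=.
      exact: le_trans E2 xb.
    exact: le_trans F2 yd.
  - move=> K; exists (x, y + m * s n.+1); split=> //=; split=> //=.
      exact: le_trans E2 xb.
    exact: le_trans cy F1.
  - move=> K; exists (x + l * s n.+1, y); split=> //=; split=> //=.
      exact: le_trans ax E1.
    exact: le_trans F2 yd.
  - move=> K; exists (x + l * s n.+1, y + m * s n.+1); split=> //=; split=> //=.
      exact: le_trans ax E1.
    exact: le_trans cy F1.
have bad0 : bad 0 (a, c).
  rewrite /bad /s /l /m expr0 !mulr1 expr1n mulr1 ![_ + (_ - _)]addrC !subrK /=.
  by split; rewrite ?lexx.
(* Dependent choice: [step] becomes a function on bad corners, iterated from [(a, c)]. *)
pose nxt n (q : {q | bad n q}) : {q | bad n.+1 q} :=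
  exist _ (sval (cid (step n (sval q) (svalP q))))
    (let: And5 H _ _ _ _ := svalP (cid (step n (sval q) (svalP q))) in H).
pose f := fix f n : {q | bad n q} :=
  if n is k.+1 then nxt k (f k) else exist _ (a, c) bad0.
pose u n := (sval (f n)).1; pose v n := (sval (f n)).2.
have fS n : [/\ u n <= u n.+1, u n.+1 + l * s n.+1 <= u n + l * s n, v n <= v n.+1 &
   v n.+1 + m * s n.+1 <= v n + m * s n].
  by rewrite /u /v /=; case: (cid _) => q /= [].
have [p pn] : exists p, forall n, u n <= p <= u n + l * s n.
  apply: nested_point => n; try by case: (fS n).
  by rewrite mulr_ge0// ltW.
have [q qn] : exists p, forall n, v n <= p <= v n + m * s n.
  apply: nested_point => n; try by case: (fS n).
  by rewrite mulr_ge0// ltW.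
have bn n : bad n (u n, v n).
  by rewrite /u /v; case: (f n) => -[].
have apb : a <= p <= b.
  by have [/= ax xb _ _ _] := bn 0; have /andP[up pu] := pn 0;
    rewrite (le_trans ax up) (le_trans pu xb).
have cqd : c <= q <= d.
  by have [/= _ _ ax xb _] := bn 0; have /andP[up pu] := qn 0;
    rewrite (le_trans ax up) (le_trans pu xb).
(* The added 1 keeps [L] positive for a degenerate rectangle. With the error N / (8 L^2),
   [rect_int_small] bounds the n-th integral by half of N s_n^2, against [bad]. *)
pose L := l + m + 1.
have L0 : 0 < L by rewrite ltr_wpDl// addr_ge0.
have e0 : 0 < N / (8 * L ^+ 2) by rewrite divr_gt0// mulr_gt0// exprn_gt0.
have [dd dd0 Hd] := derivable_modulus (dh p q apb cqd) e0.
have [n sn] : exists n, L * s n < dd.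
  exists (Num.bound (L / dd)).
  have := @upper_nthrootP R (L / dd) (Num.bound (L / dd)) (leqnn _).
  rewrite ltr_pdivrMr// => K.
  by rewrite /s exprVn ltr_pdivrMr ?exprn_gt0// mulrC.
have [/= Ha Hb Hc He HN] := bn n.
have lmL : (l + m) * s n <= L * s n by rewrite ler_pM2r// lerDl.
have dhn u' v' : u n <= u' <= u n + l * s n -> v n <= v' <= v n + m * s n ->
    derivable h (pt u' v') 1.
  move=> /andP[u1 u2] /andP[v1 v2]; apply: dh; apply/andP; split.
  - exact: le_trans Ha u1.
  - exact: le_trans u2 Hb.
  - exact: le_trans Hc v1.
  - exact: le_trans v2 He.
have := rect_int_small (pn n) (qn n) dhn Hd (ltW e0).
have -> : u n + l * s n - u n + (v n + m * s n - v n) = (l + m) * s n.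
  by ring.
move=> /(_ (le_lt_trans lmL sn)) U.
have : N * s n ^+ 2 <= 4 * (N / (8 * L ^+ 2)) * (L * s n) ^+ 2.
  apply: le_trans HN (le_trans U _); apply: ler_wpM2l.
    by rewrite mulr_ge0// ltW.
  have lm0 := mulr_ge0 (addr_ge0 l0 m0) (ltW (s0 n)).
  by apply: lerXn2r; rewrite ?nnegrE// (le_trans lm0).
have -> : 4 * (N / (8 * L ^+ 2)) * (L * s n) ^+ 2 = N * s n ^+ 2 / 2.
  by field; rewrite gt_eqF.
have : 0 < N * s n ^+ 2 by rewrite mulr_gt0// exprn_gt0.
by clear; move: (N * s n ^+ 2) => t; lra.
Qed.

End Goursat.

(** * Goursat's lemma with exceptional points, and the integral of 1/z *)

Section Cauchy.
Variable R : realType.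
Local Notation C := (Cplx R).
Implicit Types (h g : C -> C) (a b c d x y s : R) (p q z : C).

(* Weaker than continuity at [p], and all that Goursat's lemma needs there. *)
Definition weak_sing h p := forall e : R, 0 < e -> exists2 d : R, 0 < d &
  forall z, z != p -> modulus (z - p) < d -> modulus (h z) * modulus (z - p) <= e.

Lemma pt_neq x y u v : x != u \/ y != v -> pt x y != pt u v.
Proof. by move=> H; rewrite eq_complex /= negb_and; apply/orP. Qed.

Lemma itv_widen (x m1 m2 a b : R) : a <= m1 -> m2 <= b -> m1 <= x <= m2 ->
  a <= x <= b.
Proof.
by move=> am mb /andP[mx xm]; rewrite (le_trans am mx) (le_trans xm mb).
Qed.

(** The two strips cut off on the left and on the right contribute 0 by [goursat]. *)
Lemma rect_shrinkV h a b c d m1 m2 : a <= m1 -> m1 <= m2 -> m2 <= b -> c <= d ->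
  contH h a b c -> contH h a b d ->
  (forall x y, a <= x <= m1 \/ m2 <= x <= b -> c <= y <= d ->
     derivable h (pt x y) 1) ->
  rect_int h a b c d = rect_int h m1 m2 c d.
Proof.
move=> am mm mb cd hc hd dh; have mb1 := le_trans mm mb.
rewrite (rect_intV (m := m1)) // (rect_intV (a := m1) (m := m2)) //.
- rewrite goursat // ?add0r.
    rewrite [X in _ + X]goursat // ?addr0 // => x y xm.
    by apply: dh; right.
  by move=> x y xm; apply: dh; left.
- by move=> x xm; apply: hc; exact: itv_widen xm.
- by move=> x xm; apply: hd; exact: itv_widen xm.
Qed.

Lemma rect_shrinkH h a b c d m1 m2 : c <= m1 -> m1 <= m2 -> m2 <= d -> a <= b ->
  contV h a c d -> contV h b c d ->
  (forall x y, a <= x <= b -> c <= y <= m1 \/ m2 <= y <= d ->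
     derivable h (pt x y) 1) ->
  rect_int h a b c d = rect_int h a b m1 m2.
Proof.
move=> am mm mb cd hc hd dh; have mb1 := le_trans mm mb.
rewrite (rect_intH (m := m1)) // (rect_intH (c := m1) (m := m2)) //.
- rewrite goursat // ?add0r.
    rewrite [X in _ + X]goursat // ?addr0 // => x y xm ym.
    by apply: dh => //; right.
  by move=> x y xm ym; apply: dh => //; left.
- by move=> x xm; apply: hc; exact: itv_widen xm.
- by move=> x xm; apply: hd; exact: itv_widen xm.
Qed.

(** Shrink to a square of half-side eps about the point. On its boundary |z - p| >= eps, so
    [weak_sing] gives |h| <= e / eps, and the length bound 4 (e / eps)(4 eps) = 16 e is free of
    eps. *)
Lemma goursat_weak_sing h a b c d u v : a < u < b -> c < v < d ->
  (forall x y, a <= x <= b -> c <= y <= d -> x != u \/ y != v ->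
    derivable h (pt x y) 1) ->
  weak_sing h (pt u v) -> rect_int h a b c d = 0.
Proof.
move=> /andP[au ub] /andP[cv vd] dh sh.
have cu x y : a <= x <= b -> c <= y <= d -> x != u \/ y != v -> ccont h (pt x y).
  by move=> ? ? ?; apply: derivable_ccont; exact: dh.
suff small e : 0 < e -> modulus (rect_int h a b c d) <= 16 * e.
  apply/eqP; rewrite -modulus_eq0 eq_le modulus_ge0 andbT.
  rewrite leNgt; apply/negP => J0.
  have t0 : 0 < modulus (rect_int h a b c d) / 32 by rewrite divr_gt0.
  by have := small _ t0; move: (modulus _) J0 => t t1; lra.
move=> e0; have [r r0 Hr] := sh e e0.
(* The square must fit in the rectangle and in the disc of radius r; [eps + eps] appears because |z
   - p| is estimated by the sum of its coordinates. *)
have [eps [ep0 er eau ebu [ecv evd]]] : exists eps : R, [/\ 0 < eps, eps + eps < r,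
    a <= u - eps, u + eps <= b & c <= v - eps /\ v + eps <= d].
  pose t := Num.min (r / 4) (Num.min (Num.min (u - a) (b - u)) (Num.min (v - c) (d - v))).
  have t0 : 0 < t by rewrite !lt_min !subr_gt0 au ub cv vd divr_gt0.
  have : t <= t by [].
  rewrite {2}/t !le_min => /andP[? /andP[/andP[? ?] /andP[? ?]]].
  clearbody t; exists t; split=> //; try lra; split; lra.
have uu : u - eps <= u + eps by clear -ep0; lra.
have vv : v - eps <= v + eps by clear -ep0; lra.
have nu : u - eps != u by rewrite lt_eqF// ltrBlDr ltrDl.
have nu' : u + eps != u by rewrite gt_eqF// ltrDl.
have nv : v - eps != v by rewrite lt_eqF// ltrBlDr ltrDl.
have nv' : v + eps != v by rewrite gt_eqF// ltrDl.
have ab : a <= b by exact: ltW (lt_trans au ub).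
have cd : c <= d by exact: ltW (lt_trans cv vd).
have ncv : c != v by rewrite lt_eqF.
have ndv : d != v by rewrite gt_eqF.
have uE : u - eps < u < u + eps by clear -ep0; apply/andP; split; lra.
have vE : v - eps < v < v + eps by clear -ep0; apply/andP; split; lra.
rewrite (rect_shrinkV (m1 := u - eps) (m2 := u + eps)) //; first last.
- move=> x y xm yd; apply: dh => //.
    by case: xm; apply: itv_widen => //; [exact: le_trans ebu|exact: le_trans uu].
  left; case/andP: uE => u1 u2.
  by case: xm => /andP[x1 x2]; [rewrite lt_eqF// (le_lt_trans x2)|
    rewrite gt_eqF// (lt_le_trans u2)].
- by move=> x xm; apply: cu => //; [rewrite lexx cd|right].
- by move=> x xm; apply: cu => //; [rewrite lexx cd|right].
rewrite (rect_shrinkH (m1 := v - eps) (m2 := v + eps)) //; first last.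
- move=> x y xm ym; apply: dh => //; first exact: itv_widen xm.
    by case: ym; apply: itv_widen => //; [exact: le_trans evd|exact: le_trans vv].
  right; case/andP: vE => u1 u2.
  by case: ym => /andP[x1 x2]; [rewrite lt_eqF// (le_lt_trans x2)|
    rewrite gt_eqF// (lt_le_trans u2)].
- move=> x xm; apply: cu => //; [|by left].
  by apply/andP; split; [exact: le_trans uu|].
- move=> x xm; apply: cu => //; [|by left].
  by apply/andP; split => //; exact: le_trans ebu.
have cc x y : u - eps <= x <= u + eps -> v - eps <= y <= v + eps ->
    x != u \/ y != v -> ccont h (pt x y).
  by move=> xm ym; apply: cu; [exact: itv_widen xm|exact: itv_widen ym].
have bdn z : on_bd (u - eps) (u + eps) (v - eps) (v + eps) z ->
    [/\ ccont h z, z != pt u v & eps <= modulus (z - pt u v) < r].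
  case: z => x y [/= xm [ym bd]].
  have nxy : x != u \/ y != v.
    by case/or4P: bd => /eqP ->; [left|left|right|right].
  split; [exact: cc|exact: pt_neq|].
  have [mx my] := modulus_Re_Im (pt x y - pt u v).
  have mle := modulus_pt_le (x - u) (y - v).
  rewrite -/(pt x y) ptB /= in mx my mle *.
  case/andP: xm => x1 x2; case/andP: ym => y1 y2.
  apply/andP; split; last first.
    apply: le_lt_trans mle (le_lt_trans _ er).
    by clear -x1 x2 y1 y2; apply: lerD; rewrite ler_norml; apply/andP; split; lra.
  case/or4P: bd => /eqP E.
  - apply: le_trans mx; rewrite E ler_normr; apply/orP; right; clear; lra.
  - apply: le_trans mx; rewrite E ler_normr; apply/orP; left; clear; lra.
  - apply: le_trans my; rewrite E ler_normr; apply/orP; right; clear; lra.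
  - apply: le_trans my; rewrite E ler_normr; apply/orP; left; clear; lra.
have cb : cont_bd h (u - eps) (u + eps) (v - eps) (v + eps).
  by apply: cont_bdP => // z /bdn[].
have Mb z : on_bd (u - eps) (u + eps) (v - eps) (v + eps) z -> modulus (h z) <= e / eps.
  move=> /bdn[_ zp /andP[ez zr]]; rewrite ler_pdivlMr//.
  by apply: le_trans (Hr z zp zr); rewrite ler_wpM2l ?modulus_ge0.
apply: le_trans (modulus_rect_int uu vv cb Mb) _.
rewrite le_eqVlt; apply/orP; left; apply/eqP; field; rewrite gt_eqF//.
Qed.

(** A vertical ([aux1]) or horizontal ([aux2]) line through the midpoint of two distinct points
    leaves one exceptional point on each side. *)
Lemma goursat_weak_sing2 h a b c d u v u' v' :
  a < u < b -> c < v < d -> a < u' < b -> c < v' < d -> u != u' \/ v != v' ->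
  (forall x y, a <= x <= b -> c <= y <= d -> x != u \/ y != v ->
    x != u' \/ y != v' -> derivable h (pt x y) 1) ->
  weak_sing h (pt u v) -> weak_sing h (pt u' v') -> rect_int h a b c d = 0.
Proof.
have aux1 h0 (w w' z z' : R) : a < w < b -> c < z < d -> a < w' < b -> c < z' < d ->
    w < w' ->
    (forall x y, a <= x <= b -> c <= y <= d -> x != w \/ y != z ->
      x != w' \/ y != z' -> derivable h0 (pt x y) 1) ->
    weak_sing h0 (pt w z) -> weak_sing h0 (pt w' z') -> rect_int h0 a b c d = 0.
  move=> /andP[aw wb] zcd /andP[aw' wb'] zcd' ww dh s1 s2.
  have /andP[cz zd] := zcd; have /andP[cz' zd'] := zcd'.
  have cd := ltW (lt_trans cz zd).
  pose m := (w + w') / 2.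
  have [m1 m2] : w < m /\ m < w' by rewrite /m; split; lra.
  have am := ltW (lt_trans aw m1); have mb := ltW (lt_trans m2 wb').
  rewrite (rect_intV (m := m)) //.
  - rewrite (goursat_weak_sing _ zcd _ s1) ?aw ?m1 ?add0r//.
      rewrite (goursat_weak_sing _ zcd' _ s2) ?m2 ?wb'//.
      move=> x y /andP[xm xb] yd n; apply: dh => //.
        by rewrite (le_trans am xm) xb.
      by left; rewrite gt_eqF// (lt_le_trans m1).
    move=> x y /andP[xm xb] yd n; apply: dh => //.
      by rewrite xm (le_trans xb mb).
    by left; rewrite lt_eqF// (le_lt_trans xb).
  - move=> x xm; apply: derivable_ccont; apply: dh => //.
    + by rewrite lexx.
    + by right; rewrite lt_eqF.
    + by right; rewrite lt_eqF.
  - move=> x xm; apply: derivable_ccont; apply: dh => //.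
    + by rewrite lexx cd.
    + by right; rewrite gt_eqF.
    + by right; rewrite gt_eqF.
have aux2 h0 (w w' z z' : R) : a < w < b -> c < z < d -> a < w' < b -> c < z' < d ->
    z < z' ->
    (forall x y, a <= x <= b -> c <= y <= d -> x != w \/ y != z ->
      x != w' \/ y != z' -> derivable h0 (pt x y) 1) ->
    weak_sing h0 (pt w z) -> weak_sing h0 (pt w' z') -> rect_int h0 a b c d = 0.
  move=> zcd /andP[aw wb] zcd' /andP[aw' wb'] ww dh s1 s2.
  have /andP[cz zd] := zcd; have /andP[cz' zd'] := zcd'.
  have cd := ltW (lt_trans cz zd).
  pose m := (z + z') / 2.
  have [m1 m2] : z < m /\ m < z' by rewrite /m; split; lra.
  have am := ltW (lt_trans aw m1); have mb := ltW (lt_trans m2 wb').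
  rewrite (rect_intH (m := m)) //.
  - rewrite (goursat_weak_sing zcd _ _ s1) ?aw ?m1 ?add0r//.
      rewrite (goursat_weak_sing zcd' _ _ s2) ?m2 ?wb'//.
      move=> x y yd /andP[xm xb] n; apply: dh => //.
        by rewrite (le_trans am xm) xb.
      by right; rewrite gt_eqF// (lt_le_trans m1).
    move=> x y yd /andP[xm xb] n; apply: dh => //.
      by rewrite xm (le_trans xb mb).
    by right; rewrite lt_eqF// (le_lt_trans xb).
  - move=> x xm; apply: derivable_ccont; apply: dh => //.
    + by rewrite lexx.
    + by left; rewrite lt_eqF.
    + by left; rewrite lt_eqF.
  - move=> x xm; apply: derivable_ccont; apply: dh => //.
    + by rewrite lexx cd.
    + by left; rewrite gt_eqF.
    + by left; rewrite gt_eqF.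
move=> au cv au' cv' ne dh s1 s2.
have sym x y : a <= x <= b -> c <= y <= d -> x != u' \/ y != v' ->
    x != u \/ y != v -> derivable h (pt x y) 1 by move=> ? ? ? ?; exact: dh.
case: ne => [ne|ne].
  case: (ltgtP u u') => [uu|uu|E]; last by rewrite E eqxx in ne.
    exact: aux1 uu dh s1 s2.
  exact: aux1 uu sym s2 s1.
case: (ltgtP v v') => [uu|uu|E]; last by rewrite E eqxx in ne.
  exact: aux2 uu dh s1 s2.
exact: aux2 uu sym s2 s1.
Qed.

Lemma cont_bd_inv s : 0 < s -> cont_bd (fun z : C => z^-1) (- s) s (- s) s.
Proof.
move=> s0; have ss : - s <= s by lra.
apply: cont_bdP => // -[x y] [_ [_ bd]]; apply: derivable_ccont.
apply: holoV; last exact: holo_id.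
apply/negP => /eqP [x0 y0]; case/or4P: bd => /eqP /=; lra.
Qed.

(** The exact value of the integral is 2 pi i. Each side contributes at least 1 to the imaginary
    part, since the integrand there has imaginary part s / (x^2 + s^2) >= 1 / (2s) over a length
    2s. *)
Lemma Im_rect_int_inv s : 0 < s ->
  4 <= complex.Im (rect_int (fun z : C => z^-1) (- s) s (- s) s).
Proof.
move=> s0; have ss : - s <= s by lra.
have [/contH_on h1 /contH_on h2 /contV_on h3 /contV_on h4] := cont_bd_inv s0.
have -> : rect_int (fun z : C => z^-1) (- s) s (- s) s =
   cint (fun x => (pt x (- s))^-1) (- s) s + cint (fun x => -1 * (pt x s)^-1) (- s) s +
   (cint (fun y => pt 0 1 * (pt s y)^-1) (- s) s +
    cint (fun y => - pt 0 1 * (pt (- s) y)^-1) (- s) s).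
  by rewrite /rect_int !cintZ//; ring.
have k x : - s <= x <= s -> (2 * s)^-1 <= s / (x ^+ 2 + s ^+ 2).
  move=> /andP[x1 x2]; have q : x ^+ 2 <= s ^+ 2 by nra.
  have p0 : 0 < x ^+ 2 + s ^+ 2 by nra.
  by rewrite ler_pdivlMr// mulrC ler_pdivrMr; nra.
have cZ (k0 : C) (g : R -> C) : cont_on g (- s) s -> cont_on (fun x => k0 * g x) (- s) s.
  move=> cg t ts e e0; have k1 : 0 < 1 + modulus k0 by rewrite ltr_pwDl// modulus_ge0.
  have [dd dd0 H] := cg t ts _ (divr_gt0 e0 k1); exists dd => // t' /H.
  rewrite ltr_pdivlMr// -mulrBr modulusM => K; apply: le_lt_trans K.
  by rewrite mulrC ler_wpM2l ?modulus_ge0// lerDr.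
have kk : (2 * s)^-1 * (s - - s) = 1 by field; rewrite gt_eqF.
have i1 : 1 <= complex.Im (cint (fun x => (pt x (- s))^-1) (- s) s).
  rewrite -{1}kk; apply: Im_cint_ge => // t ts /=.
  by rewrite mulNr opprK sqrrN; exact: k.
have i2 : 1 <= complex.Im (cint (fun x => -1 * (pt x s)^-1) (- s) s).
  rewrite -{1}kk; apply: Im_cint_ge => //; first exact: cZ.
  move=> t ts; rewrite mulN1r /= opprK; exact: k.
have i3 : 1 <= complex.Im (cint (fun y => pt 0 1 * (pt s y)^-1) (- s) s).
  rewrite -{1}kk; apply: Im_cint_ge => //; first exact: cZ.
  move=> t ts.
  rewrite [pt 0 1 / _](_ : _ = pt (t / (s ^+ 2 + t ^+ 2)) (s / (s ^+ 2 + t ^+ 2))) /=.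
    by rewrite addrC; exact: k.
  by rewrite /pt; congr Complex => /=; ring.
have i4 : 1 <= complex.Im (cint (fun y => - pt 0 1 * (pt (- s) y)^-1) (- s) s).
  rewrite -{1}kk; apply: Im_cint_ge => //; first exact: cZ.
  move=> t ts.
  rewrite [- pt 0 1 / _](_ : _ = pt (- t / (s ^+ 2 + t ^+ 2))
    (s / (s ^+ 2 + t ^+ 2))) /=.
    by rewrite addrC; exact: k.
  by rewrite /pt; congr Complex => /=; rewrite sqrrN; ring.
move: i1 i2 i3 i4.
case: (cint (fun x => (pt x (- s))^-1) (- s) s) => ? ?.
case: (cint _ _ _) => ? ?; case: (cint _ _ _) => ? ?; case: (cint _ _ _) => ? ? /=.
lra.
Qed.

End Cauchy.

(** * Cauchy estimates *)

Section OrderBound.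
Variable R : realType.
Local Notation C := (Cplx R).
Implicit Types (f g h : C -> C) (s M x y u v : R) (p w z : C).

Lemma weak_sing_continuous h p : (forall e : R, 0 < e -> exists2 d : R, 0 < d &
    forall z, z != p -> modulus (z - p) < d -> modulus (h z * (z - p)) < e) ->
  weak_sing h p.
Proof.
move=> H e e0; have [d d0 Hd] := H e e0; exists d => // z zp zd.
by rewrite -modulusM ltW// Hd.
Qed.

(** Goursat's lemma for (g z - g 0) / z, with exceptional points 0 and [pt u v], shows that the
    integral of g / z is g 0 times that of 1/z. The latter has modulus at least 4, the former at
    most 4 (M / s)(4 s) = 16 M. *)
Lemma cauchy_center g s M u v : 0 < s -> - s < u < s -> - s < v < s ->
  pt u v != 0 ->
  (forall x y, - s <= x <= s -> - s <= y <= s -> x != u \/ y != v ->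
    derivable g (pt x y) 1) ->
  weak_sing g (pt u v) ->
  (forall z, on_bd (- s) s (- s) s z -> modulus (g z) <= M) ->
  modulus (g 0) <= 4 * M.
Proof.
move=> s0 su sv p0 dg sg gM.
have ss : - s <= s by lra.
have zz : - s < 0 < s by rewrite oppr_lt0 s0.
have z0uv : (0 : R) != u \/ (0 : R) != v.
  have [E|] := eqVneq 0 u; last by left.
  have [F|] := eqVneq 0 v; last by right.
  by rewrite -E -F eqxx in p0.
have dinv z : z != 0 -> derivable ((fun z => z^-1) : C -> C) z 1.
  by move=> z0; apply: holoV => //; exact: holo_id.
have dgB z : derivable g z 1 -> derivable (fun z => g z - g 0) z 1.
  by move=> dz; apply: holoB; [exact: dz|exact: holo_cst].
have zP : - s <= 0 <= s by rewrite oppr_le0 ltW.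
have J0 : rect_int (fun z => (g z - g 0) * z^-1) (- s) s (- s) s = 0.
  apply: (@goursat_weak_sing2 R _ _ _ _ _ 0 0 u v) => //.
  - move=> x y xs ys n1 n2; apply: holoM; last by apply: dinv; exact: pt_neq.
    by apply: dgB; exact: dg.
  - apply: weak_sing_continuous => e e0.
    have [d d0 Hd] := derivable_ccont (dg 0 0 zP zP z0uv) e0.
    exists d => // z z0 zd; rewrite subr0 mulfVK//.
    exact: Hd.
  (* At [pt u v], of modulus m: within distance m / 2 of it, |z| > m / 2, so dividing by z costs
     less than 2 / m. The parts from g z and from g 0 each receive e m / 8. *)
  - apply: weak_sing_continuous => e e0.
    have m0 : 0 < modulus (pt u v) by rewrite modulus_gt0.
    set m := modulus (pt u v) in m0.
    have em0 : 0 < e * m / 8 by rewrite divr_gt0// mulr_gt0.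
    have [d d0 Hd] := sg _ em0.
    have G0 : 0 < 1 + modulus (g 0) by rewrite ltr_pwDl// modulus_ge0.
    set G := 1 + modulus (g 0) in G0.
    have dd0 : 0 < e * m / 8 / G by rewrite !divr_gt0// mulr_gt0.
    have m20 : 0 < m / 2 by rewrite divr_gt0.
    exists (Num.min (Num.min d (m / 2)) (e * m / 8 / G)).
      by rewrite !lt_min d0 dd0 m20.
    move=> z zp; rewrite !lt_min => /andP[/andP[zd zm] zG].
    have {Hd}K := Hd z zp zd.
    have zm2 : m / 2 < modulus z.
      have := modulusD z (pt u v - z); rewrite addrC subrK -/m.
      by move: zm; rewrite modulusB; lra.
    have z0 : 0 < modulus z by exact: lt_trans zm2.
    rewrite mulrAC modulusM modulusV ltr_pdivrMr// modulusM.
    move: zG; rewrite ltr_pdivlMr// => zG.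
    have T : modulus (g z - g 0) * modulus (z - pt u v) <=
        e * m / 8 + e * m / 8.
      apply: (@le_trans _ _ ((modulus (g z) + modulus (g 0)) * modulus (z - pt u v))).
        by apply: ler_wpM2r; rewrite ?modulus_ge0// -(modulusN (g 0)) modulusD.
      rewrite mulrDl; apply: lerD => //; apply: le_trans (ltW zG).
      by rewrite mulrC ler_wpM2l ?modulus_ge0// /G lerDr.
    apply: le_lt_trans T _.
    have : e * (m / 2) < e * modulus z by rewrite ltr_pM2l.
    have : 0 < e * m by rewrite mulr_gt0.
    by move: (e * modulus z) => q; rewrite mulrA; move: (e * m) => q'; lra.
have bdP z : on_bd (- s) s (- s) s z -> s <= modulus z /\ derivable g z 1.
  case: z => x y [/= xs [ys bd]].
  have [mx my] := modulus_Re_Im (pt x y).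
  case/andP: su => u1 u2; case/andP: sv => v1 v2.
  split.
    case/or4P: bd => /eqP E.
    - by apply: le_trans mx; rewrite /= E normrN ler_norm.
    - by apply: le_trans mx; rewrite /= E ler_norm.
    - by apply: le_trans my; rewrite /= E normrN ler_norm.
    - by apply: le_trans my; rewrite /= E ler_norm.
  apply: dg => //; case/or4P: bd => /eqP ->.
  - by left; rewrite lt_eqF.
  - by left; rewrite gt_eqF.
  - by right; rewrite lt_eqF.
  - by right; rewrite gt_eqF.
have znz z : on_bd (- s) s (- s) s z -> z != 0.
  by move=> /bdP[sz _]; rewrite -modulus_gt0 (lt_le_trans s0).
have cgz : cont_bd (fun z => g z * z^-1) (- s) s (- s) s.
  apply: cont_bdP => // z bz; apply: derivable_ccont.
  by apply: holoM; [case: (bdP _ bz)|apply: dinv; exact: znz].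
have ccz : cont_bd (fun z : C => - g 0 * z^-1) (- s) s (- s) s.
  apply: cont_bdP => // z bz; apply: derivable_ccont.
  by apply: holoM; [exact: holo_cst|apply: dinv; exact: znz].
have E : rect_int (fun z => g z * z^-1) (- s) s (- s) s =
    g 0 * rect_int (fun z => z^-1) (- s) s (- s) s.
  apply/eqP; rewrite -subr_eq0 -mulNr -(rect_intZ _ (cont_bd_inv s0)).
  rewrite -rect_intD//; apply/eqP; rewrite -[RHS]J0.
  by apply: eq_rect_int => // z _; rewrite -mulrDl.
have B : modulus (rect_int (fun z => g z * z^-1) (- s) s (- s) s) <=
    4 * (M / s) * ((s - - s) + (s - - s)).
  apply: modulus_rect_int => // z bz; have [sz _] := bdP _ bz.
  rewrite modulusM modulusV; apply: ler_pM; rewrite ?invr_ge0 ?modulus_ge0//.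
    exact: gM.
  by rewrite lef_pV2// posrE// (lt_le_trans s0).
have K4 := Im_rect_int_inv s0.
have := le_trans K4 (le_trans (ler_norm _) (modulus_Re_Im _).2).
move: B; rewrite E modulusM.
have -> : 4 * (M / s) * ((s - - s) + (s - - s)) = 16 * M by field; rewrite gt_eqF.
have := modulus_ge0 (g 0).
move: (modulus _) (modulus (rect_int _ _ _ _ _)) => t r; nra.
Qed.

(** [cauchy_center] is applied to f (w + z) / (w + z)^k on the square of half-side 1/2. As |w| <
    1/4, the points w + z stay in the unit disc and satisfy |w + z| >= 1/4 on the boundary, whence
    4^k; the other 4 is that of [cauchy_center]. The smallness hypothesis says f = o(z^(k-1)),
    multiplied by |z| to avoid a subtraction in [nat]. *)
Lemma order_bound f (k : nat) M :
  (forall z, modulus z < 1 -> derivable f z 1) ->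
  (forall z, modulus z < 1 -> modulus (f z) <= M) ->
  (forall e : R, 0 < e -> exists2 d : R, 0 < d & forall z, modulus z < d ->
     modulus (f z) * modulus z <= e * modulus z ^+ k) ->
  forall w, w != 0 -> modulus w < 1 / 4 ->
  modulus (f w) <= 4 * 4 ^+ k * M * modulus w ^+ k.
Proof.
move=> df fM fo [u v] w0 w4; rewrite -/(pt u v) in w0 w4 *.
set w := pt u v in w0 w4 *.
have [mu' mv'] := modulus_Re_Im w.
have [mu mv] : `|u| < 1 / 4 /\ `|v| < 1 / 4.
  by rewrite (le_lt_trans mu')// (le_lt_trans mv').
move: mu mv; rewrite !ltr_norml => /andP[u1 u2] /andP[v1 v2].
have M0 : 0 <= M by apply: le_trans (modulus_ge0 (f 0)) (fM _ _); rewrite modulus0.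
have sq x y : - (2^-1) <= x <= 2^-1 -> - (2^-1) <= y <= 2^-1 ->
    modulus (w + pt x y) < 1.
  move=> /andP[x1 x2] /andP[y1 y2].
  apply: le_lt_trans (modulusD _ _) _.
  (* 3/4 exceeds the half-diagonal sqrt 2 / 2 of the square. *)
  suff : modulus (pt x y) <= 3 / 4 by move: w4; lra.
  rewrite -(@ler_pXn2r _ 2)// ?nnegrE ?modulus_ge0//.
  rewrite /modulus /= sqr_sqrtr ?addr_ge0 ?sqr_ge0//; nra.
pose g z := f (w + z) * ((w + z) ^+ k)^-1.
have gb : modulus (g 0) <= 4 * (M * 4 ^+ k).
  apply: (@cauchy_center g 2^-1 _ (- u) (- v)).
  - by rewrite invr_gt0.
  - by apply/andP; split; lra.
  - by apply/andP; split; lra.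
  - by rewrite [pt _ _](_ : _ = - w)// oppr_eq0.
  - move=> x y xs ys n; apply: holoM.
      have := @derivable_comp_affine R C f 1 w (pt x y).
      rewrite mul1r addrC => /(_ (df _ (sq _ _ xs ys))) [+ _].
      by under eq_fun do rewrite mul1r addrC.
    apply: holoV; last exact: holoX.
    by rewrite expf_neq0// addrC -[w]opprK subr_eq0; exact: pt_neq.
  - move=> e e0; have [d d0 Hd] := fo e e0; exists d => // z.
    have -> : pt (- u) (- v) = - w by [].
    rewrite opprK addrC -subr_eq0 opprK addrC => zw zd; have := Hd _ zd.
    rewrite /g modulusM modulusV modulusX [w + z]addrC.
    have z0 : 0 < modulus (z + w) ^+ k by rewrite exprn_gt0// modulus_gt0.
    by rewrite mulrAC ler_pdivrMr.
  - move=> z bz; rewrite /g modulusM modulusV modulusX -exprVn.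
    have zs : 2^-1 <= modulus z.
      case: z bz => x y [/= xs [ys bd]]; have [mx my] := modulus_Re_Im (pt x y).
      case/or4P: bd => /eqP E.
      - by apply: le_trans mx; rewrite /= E normrN ler_norm.
      - by apply: le_trans mx; rewrite /= E ler_norm.
      - by apply: le_trans my; rewrite /= E normrN ler_norm.
      - by apply: le_trans my; rewrite /= E ler_norm.
    have wz : 4^-1 <= modulus (w + z).
      by have := modulus_tri z w; rewrite [z + w]addrC; move: w4; lra.
    have wz0 : 0 < modulus (w + z) by apply: lt_le_trans wz; rewrite invr_gt0.
    apply: ler_pM; rewrite ?exprn_ge0 ?invr_ge0 ?modulus_ge0//.
      by apply: fM; case: z bz {zs wz wz0} => x y [/= xs [ys _]]; exact: sq.
    apply: lerXn2r; rewrite ?nnegrE ?invr_ge0 ?modulus_ge0//.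
    by rewrite -[4]invrK lef_pV2// ?posrE// invr_gt0.
move: gb; rewrite /g addr0 modulusM modulusV modulusX ler_pdivrMr; last first.
  by rewrite exprn_gt0// modulus_gt0.
by rewrite [M * _]mulrC !mulrA.
Qed.

(** Continuity at 0 bounds f by 1 on a disc of radius r. After rescaling that disc to the unit disc,
    [order_bound] with [k = 2] applies, because f = o(z). *)
Lemma second_order f : (forall z, modulus z < 1 -> derivable f z 1) ->
  f 0 = 0 -> derive1 f 0 = 0 ->
  exists K d : R, 0 < d /\
    forall z, modulus z < d -> modulus (f z) <= K * modulus z ^+ 2.
Proof.
move=> df f0 f'0; have m0 : modulus (0 : C) < 1 by rewrite modulus0.
have [r [r0 r1 Hr]] : exists r : R, [/\ 0 < r, r <= 1 &
    forall z, modulus z < r -> modulus (f z) <= 1].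
  have [r r0 Hr] := derivable_ccont (df 0 m0) ltr01.
  exists (Num.min r 1); split; rewrite ?lt_min ?r0 ?ltr01 ?ge_min ?lexx ?orbT//.
  move=> z; rewrite lt_min => /andP[zr _].
  by have := Hr z; rewrite f0 !subr0 => /(_ zr)/ltW.
pose rc : C := (r%:C)%C.
have mrc z : modulus (rc * z) = r * modulus z.
  rewrite modulusM; congr (_ * _).
  by rewrite /rc /modulus /= expr0n addr0 sqrtr_sqr gtr0_norm.
pose g z := f (rc * z + 0).
have dg z : modulus z < 1 -> derivable g z 1.
  move=> z1; apply: (@derivable_comp_affine R C f rc 0 z _).1; apply: df.
  by rewrite addr0 mrc; apply: le_lt_trans z1; rewrite ler_piMl ?modulus_ge0.
have gM z : modulus z < 1 -> modulus (g z) <= 1.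
  move=> z1; apply: Hr; rewrite addr0 mrc.
  by rewrite -[ltRHS]mulr1 ltr_pM2l.
exists (4 * 4 ^+ 2 * 1 / r ^+ 2), (r / 4); split; first exact: divr_gt0.
move=> z zr; have [->|z0] := eqVneq z 0.
  by rewrite f0 modulus0 expr0n mulr0.
have := @order_bound g 2 1 dg gM _ (rc^-1 * z).
have mz : modulus (rc^-1 * z) = modulus z / r.
  have rc0 : rc != 0 by rewrite eq_complex /= gt_eqF.
  have <- : r * modulus (rc^-1 * z) = modulus z by rewrite -mrc mulVKf.
  by rewrite mulrAC divff ?mul1r// gt_eqF.
rewrite mz {2}/g addr0 mulVKf; last by rewrite eq_complex /= gt_eqF.
rewrite expr_div_n mulrA mulrAC; apply.
- move=> e e0; have [d d0 Hd] := derivable_modulus (df 0 m0) (divr_gt0 e0 r0).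
  exists (d / r); first exact: divr_gt0.
  move=> x; rewrite ltr_pdivlMr// mulrC -mrc => xd.
  have := Hd (rc * x); rewrite f0 f'0 mulr0 !subr0 => /(_ xd).
  rewrite mrc mulrA divfK ?gt_eqF// /g addr0 expr2 mulrA => ?.
  by apply: ler_wpM2r => //; exact: modulus_ge0.
- by rewrite mulf_neq0// invr_neq0// eq_complex /= gt_eqF.
- by rewrite ltr_pdivrMr// mulrC mul1r.
Qed.

End OrderBound.

(** * Invariants of 3x3 matrices *)

Section Matrix3.
Variable K : comNzRingType.

Lemma forall_ord3 (P : 'I_3 -> Prop) : P 0 -> P 1 -> P 2 -> forall i, P i.
Proof.
move=> p0 p1 p2 [] [|[|[|//]]] H.
- by rewrite (_ : Ordinal H = 0)//; exact: val_inj.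
- by rewrite (_ : Ordinal H = 1)//; exact: val_inj.
- by rewrite (_ : Ordinal H = 2)//; exact: val_inj.
Qed.

Lemma sum_ord3 (V : nmodType) (F : 'I_3 -> V) : \sum_(i < 3) F i = F 0 + F 1 + F 2.
Proof.
rewrite !big_ord_recl big_ord0 addr0 addrA.
by congr (F _ + F _ + F _); exact: val_inj.
Qed.

Lemma det2E (A : 'M[K]_2) : \det A = A 0 0 * A 1 1 - A 0 1 * A 1 0.
Proof.
have l00 : lift 0 0 = 1 :> 'I_2 by exact: val_inj.
have l10 : lift 1 0 = 0 :> 'I_2 by exact: val_inj.
rewrite (expand_det_row _ 0) !big_ord_recl big_ord0 /cofactor !det_mx11 !mxE.
by rewrite !(l00, l10) /= expr0 expr1; ring.
Qed.

Lemma det3E (A : 'M[K]_3) : \det A =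
  A 0 0 * (A 1 1 * A 2 2 - A 1 2 * A 2 1) - A 0 1 * (A 1 0 * A 2 2 - A 1 2 * A 2 0)
  + A 0 2 * (A 1 0 * A 2 1 - A 1 1 * A 2 0).
Proof.
have l00 : lift 0 0 = 1 :> 'I_3 by exact: val_inj.
have l01 : lift 0 1 = 2 :> 'I_3 by exact: val_inj.
have l10 : lift 1 0 = 0 :> 'I_3 by exact: val_inj.
have l11 : lift 1 1 = 2 :> 'I_3 by exact: val_inj.
have l20 : lift 2 0 = 0 :> 'I_3 by exact: val_inj.
have l21 : lift 2 1 = 1 :> 'I_3 by exact: val_inj.
rewrite (expand_det_row _ 0) sum_ord3 /cofactor !det2E !mxE.
by rewrite !(l00, l01, l10, l11, l20, l21) /= expr0 expr1 sqrrN expr1n; ring.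
Qed.

End Matrix3.

Section CharPoly3.
Variable K : comNzRingType.

Definition second_minors (A : 'M[K]_3) := A 0 0 * A 1 1 - A 0 1 * A 1 0 +
  (A 0 0 * A 2 2 - A 0 2 * A 2 0) + (A 1 1 * A 2 2 - A 1 2 * A 2 1).

Lemma char_poly3E (A : 'M[K]_3) : char_poly A =
  'X^3 - (A 0 0 + A 1 1 + A 2 2)%:P * 'X^2 + (second_minors A)%:P * 'X - (\det A)%:P.
Proof.
rewrite /char_poly (det3E (char_poly_mx A)) /char_poly_mx !mxE /= !mulr1n !mulr0n.
rewrite (det3E A) /second_minors.
by rewrite !(polyCB, polyCD, polyCM); ring.
Qed.

Lemma coef_cubic (a b c : K) : let p := 'X^3 - a%:P * 'X^2 + b%:P * 'X - c%:P in
  [/\ p`_2 = - a, p`_1 = b & p`_0 = - c].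
Proof.
by rewrite /= !mul_polyC !coefE /= !(mulr0, mulr1, sub0r, subr0, addr0, add0r, oppr0).
Qed.

End CharPoly3.

Section SpectralBall3.
Variable R : realType.
Local Notation C := (Cplx R).
Implicit Types (A : 'M[C]_3) (l a b c : C).

Lemma sigma3E A :
  [/\ sigma 1 A = A 0 0 + A 1 1 + A 2 2, sigma 2 A = second_minors A &
      sigma 3 A = \det A].
Proof.
have := coef_cubic (A 0 0 + A 1 1 + A 2 2) (second_minors A) (\det A).
rewrite /= -char_poly3E => -[c2 c1 c0].
by rewrite /sigma (_ : (3 - 1)%N = 2%N)// (_ : (3 - 2)%N = 1%N)// subnn c2 c1 c0;
  split; rewrite ?expr1 ?sqrrN ?expr1n ?exprS ?expr0; ring.
Qed.

Lemma eigenvalue3E A l : eigenvalue A l =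
  (l ^+ 3 - (A 0 0 + A 1 1 + A 2 2) * l ^+ 2 + second_minors A * l - \det A == 0).
Proof.
by rewrite eigenvalue_root_char char_poly3E rootE !hornerE.
Qed.

Lemma char_poly3_roots A : exists x y z : C,
  [/\ A 0 0 + A 1 1 + A 2 2 = x + y + z, second_minors A = x * y + x * z + y * z &
      \det A = x * y * z].
Proof.
have [r pr] := closed_field_poly_normal (char_poly A : {poly R[i]}).
move: pr (size_char_poly A); rewrite (eqP (char_poly_monic A)) scale1r => pr.
rewrite pr size_prod_XsubC => -[sr].
case: r sr pr => [|x [|y [|z [|]]]] //= _.
rewrite !big_cons big_nil mulr1 char_poly3E.
have -> : ('X - x%:P) * (('X - y%:P) * ('X - z%:P)) =
  'X^3 - (x + y + z)%:P * 'X^2 + (x * y + x * z + y * z)%:P * 'X - (x * y * z)%:P.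
  by rewrite !(polyCD, polyCM); ring.
have [p2 p1 p0] := coef_cubic (A 0 0 + A 1 1 + A 2 2) (second_minors A) (\det A).
have [q2 q1 q0] := coef_cubic (x + y + z) (x * y + x * z + y * z) (x * y * z).
move=> E; exists x, y, z; split.
- by apply: oppr_inj; rewrite -p2 -q2 E.
- by rewrite -p1 -q1 E.
- by apply: oppr_inj; rewrite -p0 -q0 E.
Qed.

(** By Vieta's formulas, sigma2 is a sum of three products of eigenvalues and the determinant is a
    single product. *)
Lemma spectral_ball_bounds A : spectral_ball A ->
  modulus (second_minors A) <= 3 /\ modulus (\det A) <= 1.
Proof.
rewrite /spectral_ball /= /spectral_radius => Ab.
have [x [y [z [E2 E1 E0]]]] := char_poly3_roots A.
have ev l : eigenvalue A l = [|| l == x, l == y | l == z].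
  rewrite eigenvalue3E E2 E1 E0.
  have -> : l ^+ 3 - (x + y + z) * l ^+ 2 + (x * y + x * z + y * z) * l - x * y * z
    = (l - x) * ((l - y) * (l - z)) by ring.
  by rewrite !mulf_eq0 !subr_eq0.
(* Boundedness must be known before [sup] can be said to dominate the eigenvalues. *)
have ubd : has_ubound [set modulus l | l in spectrum A].
  exists (modulus x + modulus y + modulus z) => _ [l + <-].
  rewrite /spectrum /= ev; have := modulus_ge0 x; have := modulus_ge0 y.
  by have := modulus_ge0 z; move=> ? ? ? /or3P[] /eqP ->; lra.
have lt1 l : eigenvalue A l -> modulus l <= 1.
  move=> el; apply: ltW; apply: le_lt_trans Ab; apply: ub_le_sup => //.
  by exists l.
have x1 : modulus x <= 1 by apply: lt1; rewrite ev eqxx.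
have y1 : modulus y <= 1 by apply: lt1; rewrite ev eqxx orbT.
have z1 : modulus z <= 1 by apply: lt1; rewrite ev eqxx !orbT.
have := modulus_ge0 x; have := modulus_ge0 y; have := modulus_ge0 z => z0 y0 x0.
rewrite E1 E0 !modulusM; split; last by rewrite !mulr_ile1 ?mulr_ge0.
apply: le_trans (modulusD _ _) _.
apply: le_trans (lerD (modulusD _ _) (lexx _)) _; rewrite !modulusM.
have := mulr_ile1 x0 y0 x1 y1; have := mulr_ile1 x0 z0 x1 z1.
have := mulr_ile1 y0 z0 y1 z1; lra.
Qed.

Lemma spectral_ball_suff n (A : 'M[C]_n) (r : R) : r < 1 ->
  (forall l, eigenvalue A l -> modulus l <= r) -> spectral_ball A.
Proof.
move=> r1 H; rewrite /spectral_ball /= /spectral_radius.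
(* The supremum of the empty set is 0 by convention, which is below 1. *)
have [->|/set0P ne] := eqVneq [set modulus l | l in spectrum A] set0.
  by rewrite sup0.
by apply: le_lt_trans r1; apply: ge_sup => // _ [l + <-]; exact: H.
Qed.

End SpectralBall3.

(** * Differentiability of matrix-valued maps, entry by entry *)

Section MatrixEntries.
Variables (R : realType) (n : nat).
Local Notation C := (Cplx R).
Implicit Types (A : 'M[C]_n) (phi : C -> 'M[C]_n).

Lemma mx_norm_entry A i j : `|A i j| <= `|A|.
Proof.
rewrite [leRHS]mx_normE -[leLHS]nngE num_le.
exact: (le_bigmax _ _ (i, j)).
Qed.

Lemma mx_norm_le A (c : C) : 0 <= c -> (forall i j, `|A i j| <= c) -> `|A| <= c.
Proof.
move=> c0 H; have [A0|A0] := eqVneq (mx_norm A) 0.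
  by rewrite [leLHS]A0.
by have [[i j] Eij] := mx_norm_neq0 A0; rewrite [leLHS]Eij; exact: H.
Qed.

Lemma derivable_entry phi z i j : derivable phi z 1 ->
  derivable (fun x => phi x i j) z 1 /\
  derive1 (fun x => phi x i j) z = derive1 phi z i j.
Proof.
move=> dphi; apply: expand_derivable => e e0.
have [d d0 H] := derivable_expand dphi e0; exists d => // z' /H.
by apply: le_trans; apply: le_trans (mx_norm_entry _ i j); rewrite !mxE.
Qed.

Lemma entries_derivable phi z (D : 'M[C]_n) :
  (forall i j, derivable (fun x => phi x i j) z 1 /\
    derive1 (fun x => phi x i j) z = D i j) ->
  derivable phi z 1 /\ derive1 phi z = D.
Proof.
move=> H; apply: expand_derivable => e e0.
have K (ij : 'I_n * 'I_n) : exists2 d : R, 0 < d & forall z', modulus (z' - z) < d ->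
    `|phi z' ij.1 ij.2 - phi z ij.1 ij.2 - (z' - z) * D ij.1 ij.2| <=
       ((e * modulus (z' - z))%:C)%C.
  by have [dij <-] := H ij.1 ij.2; exact: derivable_expand.
have [d dP] := choice (fun ij =>
  let: ex_intro2 d d0 Hd := K ij in ex_intro _ d (conj d0 Hd)).
exists (\big[Num.min/1]_ij d ij).
  by elim/big_ind: _ => // [x y x0 y0|ij _]; rewrite ?lt_min ?x0//; case: (dP ij).
move=> z' zd; apply: mx_norm_le.
  by rewrite lecR mulr_ge0 ?modulus_ge0 ?ltW.
move=> i j; rewrite !mxE; have [_] := dP (i, j); apply.
apply: lt_le_trans zd _.
by rewrite (bigD1 (i, j)) //= ge_min lexx.
Qed.

End MatrixEntries.

(** * Orders of vanishing at 0 *)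

Section BigO.
Variable R : realType.
Local Notation C := (Cplx R).
Implicit Types (f g : C -> C) (j k : nat).

Definition bigO_at0 k f := exists K d : R, 0 < d /\
  forall z, modulus z < d -> modulus (f z) <= K * modulus z ^+ k.

Lemma bigO_at0M j k f g : bigO_at0 j f -> bigO_at0 k g ->
  bigO_at0 (j + k) (fun z => f z * g z).
Proof.
move=> [K [d [d0 H]]] [L [e [e0 G]]]; exists (K * L), (Num.min d e).
split; first by rewrite lt_min d0.
move=> z; rewrite lt_min => /andP[/H {}H /G {}G].
by rewrite modulusM exprD mulrACA; apply: ler_pM => //; exact: modulus_ge0.
Qed.

Lemma bigO_at0D k f g : bigO_at0 k f -> bigO_at0 k g ->
  bigO_at0 k (fun z => f z + g z).
Proof.
move=> [K [d [d0 H]]] [L [e [e0 G]]]; exists (K + L), (Num.min d e).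
split; first by rewrite lt_min d0.
move=> z; rewrite lt_min => /andP[/H {}H /G {}G].
by apply: le_trans (modulusD _ _) _; rewrite mulrDl; exact: lerD.
Qed.

Lemma bigO_at0N k f : bigO_at0 k f -> bigO_at0 k (fun z => - f z).
Proof.
move=> [K [d [d0 H]]]; exists K, d; split=> // z /H; by rewrite modulusN.
Qed.

Lemma bigO_at0B k f g : bigO_at0 k f -> bigO_at0 k g ->
  bigO_at0 k (fun z => f z - g z).
Proof. by move=> Hf /bigO_at0N Hg; exact: bigO_at0D. Qed.

Lemma bigO_at0S k f : bigO_at0 k.+1 f -> bigO_at0 k f.
Proof.
move=> [K [d [d0 H]]]; exists `|K|, (Num.min d 1); split; first by rewrite lt_min d0/=.
move=> z; rewrite lt_min => /andP[/H {}H z1]; apply: le_trans H _.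
rewrite exprS mulrA; apply: ler_wpM2r; first by rewrite exprn_ge0 ?modulus_ge0.
apply: le_trans (ler_norm _) _; rewrite normrM (ger0_norm (modulus_ge0 z)).
by rewrite ler_piMr// ltW.
Qed.

Lemma derivable_bigO0 f : derivable f 0 1 -> bigO_at0 0 f.
Proof.
move=> df; have [d d0 H] := derivable_ccont df ltr01.
exists (1 + modulus (f 0)), d; split=> // z zd; rewrite expr0 mulr1.
rewrite -(subrK (f 0) (f z)); apply: le_trans (modulusD _ _) _.
by rewrite lerD2r ltW// H// subr0.
Qed.

Lemma derivable_bigO1 f : derivable f 0 1 -> f 0 = 0 -> bigO_at0 1 f.
Proof.
move=> df f0; have [d d0 H] := derivable_modulus df ltr01.
exists (1 + modulus (derive1 f 0)), d; split=> // z zd.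
have := H z; rewrite f0 !subr0 => /(_ zd); rewrite mul1r expr1 => K.
rewrite -(subrK (z * derive1 f 0) (f z)); apply: le_trans (modulusD _ _) _.
by rewrite mulrDl mul1r modulusM [modulus z * _]mulrC lerD2r.
Qed.

(** Produces the smallness hypothesis of [order_bound], which trades the constant hidden in
    [bigO_at0] for one that depends only on a bound over the disc. *)
Lemma bigO_little k f : bigO_at0 k f -> forall e : R, 0 < e ->
  exists2 d : R, 0 < d & forall z, modulus z < d ->
    modulus (f z) * modulus z <= e * modulus z ^+ k.
Proof.
move=> [K [d [d0 H]]] e e0.
have K0 : 0 < 1 + `|K| by rewrite ltr_pwDl.
exists (Num.min d (e / (1 + `|K|))); first by rewrite lt_min d0 divr_gt0.
move=> z; rewrite lt_min => /andP[/H {}H]; rewrite ltr_pdivlMr// => zK.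
apply: le_trans (ler_wpM2r (modulus_ge0 z) H) _.
rewrite mulrAC; apply: ler_wpM2r; first by rewrite exprn_ge0 ?modulus_ge0.
apply: le_trans (ltW zK); rewrite mulrC; apply: ler_wpM2l; first exact: modulus_ge0.
by apply: le_trans (ler_norm _) _; rewrite lerDr.
Qed.

End BigO.

(** * The obstruction *)

Section Obstruction.
Variable R : realType.
Local Notation C := (Cplx R).
Implicit Types phi : C -> 'M[C]_3.

Lemma disc_modulus (z : C) : disc z <-> modulus z < 1.
Proof. by rewrite /disc /= normcE_modulus ltcR. Qed.

Lemma modulus_real (r : R) : 0 <= r -> modulus ((r%:C)%C : C) = r.
Proof. by move=> r0; rewrite /modulus /= expr0n addr0 sqrtr_sqr ger0_norm. Qed.

(* The bound 20 is not sharp. *)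
Lemma obstruction phi : holomorphic_map disc spectral_ball phi ->
  phi 0 = A_tilde R ->
  let D := derive1 phi 0 in
  D 0 0 + D 1 1 + D 2 2 = 0 -> D 0 1 = 0 -> D 2 0 = 0 -> D 2 1 = 0 ->
  modulus (D 0 0) <= 20.
Proof.
move=> hphi phi0 D trD D01 D20 D21.
have hd z : modulus z < 1 -> derivable phi z 1.
  by move=> /disc_modulus /hphi [].
have dE i j z : modulus z < 1 -> derivable (fun x => phi x i j) z 1.
  by move=> /hd /(derivable_entry i j) [].
have m0 : modulus (0 : C) < 1 by rewrite modulus0.
have DE i j : derive1 (fun x => phi x i j) 0 = D i j.
  by have [] := derivable_entry i j (hd 0 m0).
pose p i j z := phi z i j.
have p0 i j : p i j 0 = (i == 1)%:R * (j == 2)%:R.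
  by rewrite /p phi0 /A_tilde mxE -natrM mulnb.
have o1 i j : (i != 1) || (j != 2) -> bigO_at0 1 (p i j).
  move=> ij; apply: derivable_bigO1; first exact: dE.
  by rewrite p0 -natrM mulnb; case: (i == 1) (j == 2) ij => [] [].
have o0 i j : bigO_at0 0 (p i j) by apply: derivable_bigO0; exact: dE.
have o2 i j : (i != 1) || (j != 2) -> D i j = 0 -> bigO_at0 2 (p i j).
  move=> ij Dij; apply: second_order; first by move=> z; exact: dE.
    by rewrite p0 -natrM mulnb; case: (i == 1) (j == 2) ij => [] [].
  exact: etrans (DE i j) Dij.
pose T z := p 0 0 z + p 1 1 z + p 2 2 z.
have oT : bigO_at0 2 T.
  apply: second_order; last first.
  - have d00 := dE 0 0 0 m0; have d11 := dE 1 1 0 m0; have d22 := dE 2 2 0 m0.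
    have E1 := derive1_add d00 d11.
    have E2 := derive1_add (holoD d00 d11) d22.
    by apply: (etrans E2); rewrite E1 !DE.
  - by rewrite /T !p0 /=; ring.
  - move=> z z1; apply: holoD; last exact: dE.
    by apply: holoD; exact: dE.
have [b00 b11 b22 b02 b10] : [/\ bigO_at0 1 (p 0 0), bigO_at0 1 (p 1 1),
    bigO_at0 1 (p 2 2), bigO_at0 1 (p 0 2) & bigO_at0 1 (p 1 0)].
  by split; apply: o1.
have [b01 b20 b21] : [/\ bigO_at0 2 (p 0 1), bigO_at0 2 (p 2 0) & bigO_at0 2 (p 2 1)].
  by split; apply: o2.
have b12 := o0 1 2.
pose F z := second_minors (phi z); pose G z := \det (phi z).
(* Orders add up in each product. The entry [p 1 2] is only O(1), but it always comes with [p 2 1]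
   or [p 2 0], which are O(z^2). *)
have oF2 : bigO_at0 2 F.
  apply: bigO_at0D; [apply: bigO_at0D|]; apply: bigO_at0B.
  - exact: (bigO_at0M b00 b11).
  - exact/bigO_at0S/(bigO_at0M b01 b10).
  - exact: (bigO_at0M b00 b22).
  - exact/bigO_at0S/(bigO_at0M b02 b20).
  - exact: (bigO_at0M b11 b22).
  - exact: (bigO_at0M b12 b21).
have GE : G = (fun z =>
   p 0 0 z * (p 1 1 z * p 2 2 z - p 1 2 z * p 2 1 z) -
   p 0 1 z * (p 1 0 z * p 2 2 z - p 1 2 z * p 2 0 z)
   + p 0 2 z * (p 1 0 z * p 2 1 z - p 1 1 z * p 2 0 z)).
  by apply/funext => z; exact: det3E.
have oG3 : bigO_at0 3 G.
  rewrite GE; apply: bigO_at0D; [apply: bigO_at0B|].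
  - apply: (bigO_at0M b00); apply: bigO_at0B.
      exact: (bigO_at0M b11 b22).
    exact: (bigO_at0M b12 b21).
  - apply/bigO_at0S/(bigO_at0M b01); apply: bigO_at0B.
      exact: (bigO_at0M b10 b22).
    exact: (bigO_at0M b12 b20).
  - apply/bigO_at0S/(bigO_at0M b02); apply: bigO_at0B.
      exact: (bigO_at0M b10 b21).
    exact: (bigO_at0M b11 b20).
have dF z : modulus z < 1 -> derivable F z 1.
  by move=> z1; apply: holoD; [apply: holoD|]; apply: holoB; apply: holoM; exact: dE.
have dG z : modulus z < 1 -> derivable G z 1.
  move=> z1; rewrite GE; apply: holoD; [apply: holoB|];
    (apply: holoM; [exact: dE|apply: holoB; apply: holoM; exact: dE]).
have bnd z : modulus z < 1 -> modulus (F z) <= 3 /\ modulus (G z) <= 1.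
  by move=> /disc_modulus /hphi [_ /spectral_ball_bounds].
have FB := order_bound dF (fun z z1 => (bnd z z1).1) (bigO_little oF2).
have GB := order_bound dG (fun z z1 => (bnd z z1).2) (bigO_little oG3).
(* This is p00^2 T + det (p00 I - phi): [key] is the characteristic polynomial of phi evaluated at
   p00. The matrix p00 I - phi has corner entry 0, so each term of its determinant contains an
   off-corner entry of the first row and one of the first column, and has order at least 4. *)
pose E z := p 0 0 z * p 0 0 z * T z - p 0 0 z * (p 0 1 z * p 1 0 z)
   - p 0 0 z * (p 0 2 z * p 2 0 z)
   + p 0 1 z * (p 1 0 z * p 2 2 z) - p 0 1 z * (p 1 2 z * p 2 0 z)
   - p 0 2 z * (p 1 0 z * p 2 1 z) + p 0 2 z * (p 1 1 z * p 2 0 z).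
have oE4 : bigO_at0 4 E.
  apply: bigO_at0D; [apply: bigO_at0B; [apply: bigO_at0B; [apply: bigO_at0D;
    [apply: bigO_at0B; [apply: bigO_at0B|]|]|]|]|].
  - exact: (bigO_at0M (bigO_at0M b00 b00) oT).
  - exact: (bigO_at0M b00 (bigO_at0M b01 b10)).
  - exact: (bigO_at0M b00 (bigO_at0M b02 b20)).
  - exact: (bigO_at0M b01 (bigO_at0M b10 b22)).
  - exact: (bigO_at0M b01 (bigO_at0M b12 b20)).
  - exact: (bigO_at0M b02 (bigO_at0M b10 b21)).
  - exact: (bigO_at0M b02 (bigO_at0M b11 b20)).
have key z : p 0 0 z ^+ 3 = G z - p 0 0 z * F z + E z.
  by rewrite GE /F /E /T /second_minors -!/(p _ _ _); ring.
rewrite leNgt; apply/negP => D20'.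
have e0 : 0 < modulus (D 0 0) - 20 by rewrite subr_gt0.
have [d d0 Hd] := derivable_modulus (dE 0 0 0 m0) e0.
have [K [d' [d'0 HE]]] := oE4.
(* r lies within the range of the derivative estimate and of the O(z^4) bound, below the 1/4 of
   [order_bound], and satisfies K r <= 1, so that E is at most r^3. *)
pose r := Num.min (Num.min (d / 2) (d' / 2)) (Num.min (1 / 8) (1 + `|K|)^-1).
have K0 : 0 < 1 + `|K| by rewrite ltr_pwDl.
have r0 : 0 < r by rewrite !lt_min !divr_gt0// invr_gt0.
have : r <= r by [].
rewrite {2}/r !le_min => /andP[/andP[rd rd'] /andP[r8 rK]].
pose z : C := (r%:C)%C.
have mz : modulus z = r by apply: modulus_real; exact: ltW.
have z0 : z != 0 by rewrite -modulus_gt0 mz.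
have FBz : modulus (F z) <= 192 * r ^+ 2.
  have := FB z z0; rewrite mz; have -> : 4 * 4 ^+ 2 * 3 = 192 :> R by ring.
  by apply; clear -r8; lra.
have GBz : modulus (G z) <= 256 * r ^+ 3.
  have := GB z z0; rewrite mz; have -> : 4 * 4 ^+ 3 * 1 = 256 :> R by ring.
  by apply; clear -r8; lra.
have EBz : modulus (E z) <= r ^+ 3.
  have := HE z; rewrite mz => H; apply: le_trans (H _) _; first by clear -rd' d'0; lra.
  rewrite exprS mulrA; apply: ler_piMl; first by rewrite exprn_ge0// ltW.
  apply: (@le_trans _ _ ((1 + `|K|) * r)); last by rewrite mulrC -ler_pdivlMr// div1r.
  by rewrite ler_pM2r// (le_trans (ler_norm _))// lerDr.
(* The derivative error was chosen as |D00| - 20, which leaves r |D00| - (|D00| - 20) r = 20 r. *)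
have xr : 20 * r <= modulus (p 0 0 z).
  have H := Hd z; rewrite subr0 mz -/(p 0 0 0) -/(p 0 0 z) p0 DE /= mul0r subr0 in H.
  have {}H : modulus (p 0 0 z - z * D 0 0) <= (modulus (D 0 0) - 20) * r.
    by apply: H; clear -rd d0; lra.
  have := modulusD (p 0 0 z) (z * D 0 0 - p 0 0 z).
  rewrite addrC subrK modulusM mz modulusB; move: H.
  rewrite mulrBl [modulus (D 0 0) * r]mulrC; clear.
  by move: (r * modulus (D 0 0)) (modulus _) (modulus _) => ? ? ?; lra.
have : modulus (p 0 0 z) ^+ 3 <=
    256 * r ^+ 3 + modulus (p 0 0 z) * (192 * r ^+ 2) + r ^+ 3.
  rewrite -modulusX key; apply: le_trans (modulusD _ _) _; apply: lerD => //.
  apply: le_trans (modulusD _ _) _; rewrite modulusN; apply: lerD => //.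
  by rewrite modulusM; apply: ler_wpM2l => //; exact: modulus_ge0.
move: (modulus (p 0 0 z)) xr => x xr.
have r20 : 0 <= r ^+ 2 by rewrite exprn_ge0// ltW.
have x0 : 0 <= x by apply: le_trans xr; rewrite mulr_ge0// ltW.
(* From x >= 20 r: x^3 >= 400 r^2 x, against x^3 <= 257 r^3 + 192 r^2 x. The difference 208 r^2 x is
   at least 4160 r^3, a contradiction. *)
have x2 : 400 * r ^+ 2 * x <= x ^+ 3.
  rewrite [x ^+ 3]exprSr; apply: ler_wpM2r => //.
  have -> : 400 * r ^+ 2 = (20 * r) ^+ 2 by ring.
  by apply: lerXn2r => //; rewrite nnegrE// mulr_ge0// ltW.
have r3 : 0 < r ^+ 3 by rewrite exprn_gt0.
have : 20 * r ^+ 3 <= x * r ^+ 2.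
  by rewrite [r ^+ 3]exprS mulrA; apply: ler_wpM2r.
move: x2; rewrite [400 * _ * x](_ : _ = 400 * (x * r ^+ 2)); last by ring.
rewrite [x * (192 * _)](_ : _ = 192 * (x * r ^+ 2)); last by ring.
move: (x ^+ 3) (x * r ^+ 2) (r ^+ 3) r3 => X Y Z; clear; lra.
Qed.

End Obstruction.

(** * Lowest homogeneous terms *)

Section LowestTerm.
Variables (R : realType) (n : nat).
Local Notation C := (Cplx R).
Implicit Types (P Q g : 'M[C]_n -> C) (A X Y : 'M[C]_n).

Lemma homogeneous_eq m P Q : (forall X, P X = Q X) -> homogeneous_poly m Q ->
  homogeneous_poly m P.
Proof. by move=> PQ [c H]; exists c => X; rewrite PQ H. Qed.

Lemma homogeneous0 m : homogeneous_poly m (fun _ : 'M[C]_n => (0 : C)).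
Proof. by exists (fun=> 0) => X; rewrite big1// => e _; rewrite mul0r. Qed.

Lemma homogeneousD m P Q : homogeneous_poly m P -> homogeneous_poly m Q ->
  homogeneous_poly m (fun X => P X + Q X).
Proof.
move=> [c Pc] [d Qd]; exists (fun e => c e + d e) => X.
by rewrite Pc Qd -big_split; apply: eq_bigr => e _ /=; rewrite mulrDl.
Qed.

Lemma homogeneousZ m k P : homogeneous_poly m P ->
  homogeneous_poly m (fun X => k * P X).
Proof.
move=> [c Pc]; exists (fun e => k * c e) => X.
by rewrite Pc mulr_sumr; apply: eq_bigr => e _ /=; rewrite mulrA.
Qed.

Lemma homogeneousB m P Q : homogeneous_poly m P -> homogeneous_poly m Q ->
  homogeneous_poly m (fun X => P X - Q X).
Proof.
move=> hP /(homogeneousZ (-1)) hQ; apply: homogeneous_eq (homogeneousD hP hQ).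
by move=> X; rewrite mulN1r.
Qed.

Lemma homogeneous_monomial (s : seq ('I_n * 'I_n)) :
  homogeneous_poly (size s) (fun X => \prod_(p <- s) X p.1 p.2).
Proof.
exists (fun e => (e == [ffun i => tnth (in_tuple s) i])%:R) => X.
rewrite [RHS](bigD1 [ffun i => tnth (in_tuple s) i]) //= eqxx mul1r.
rewrite [X in _ + X]big1 ?addr0.
  by rewrite big_tnth; apply: eq_bigr => i _; rewrite ffunE.
by move=> e /negPf ->; rewrite mul0r.
Qed.

Lemma homogeneous_entry i j : homogeneous_poly 1 (fun X => X i j).
Proof.
apply: homogeneous_eq (homogeneous_monomial [:: (i, j)]).
by move=> X; rewrite big_seq1.
Qed.

Lemma homogeneous_entry2 i j k l : homogeneous_poly 2 (fun X => X i j * X k l).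
Proof.
apply: homogeneous_eq (homogeneous_monomial [:: (i, j); (k, l)]).
by move=> X; rewrite big_cons big_seq1.
Qed.

Lemma homogeneous_entry3 i j k l u v :
  homogeneous_poly 3 (fun X => X i j * X k l * X u v).
Proof.
apply: homogeneous_eq (homogeneous_monomial [:: (i, j); (k, l); (u, v)]).
by move=> X; rewrite !big_cons big_nil mulr1 mulrA.
Qed.

Lemma homogeneous_scale m P s X : homogeneous_poly m P ->
  P (s *: X) = s ^+ m * P X.
Proof.
move=> [c Pc]; rewrite !Pc mulr_sumr; apply: eq_bigr => e _.
rewrite mulrCA; congr (_ * _).
under eq_bigr do rewrite mxE.
by rewrite big_split /= prodr_const card_ord.
Qed.

Lemma homogeneous_bound m P : homogeneous_poly m P ->
  exists K : C, 0 <= K /\ forall X, `|P X| <= K * `|X| ^+ m.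
Proof.
move=> [c Pc]; exists (\sum_e `|c e|); split; first exact: sumr_ge0.
move=> X; rewrite Pc mulr_suml; apply: le_trans (ler_norm_sum _ _ _) _.
apply: ler_sum => e _; rewrite normrM; apply: ler_wpM2l => //.
have -> : `|X| ^+ m = \prod_(i < m) `|X| by rewrite prodr_const card_ord.
rewrite normr_prod; apply: ler_prod => i _.
by rewrite normr_ge0 /=; exact: mx_norm_entry.
Qed.

(** Restriction to a complex line through A reduces the comparison of expansions to powers of the
    single variable s. *)
Lemma little_direction m g A P :
  (fun X => g X - g A - P (X - A)) =o_A (fun X => `|X - A| ^+ m) ->
  homogeneous_poly m P -> forall X, forall e : R, 0 < e ->
  exists2 d : R, 0 < d & forall s : C, modulus s < d ->
    modulus (g (A + s *: X) - g A - s ^+ m * P X) <= e * modulus s ^+ m.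
Proof.
move=> /eqoP gP hP X e e0.
have realE (x : C) : 0 <= x -> x = ((complex.Re x)%:C)%C.
  by case: x => a b; rewrite lecE /= => /andP[/eqP -> _].
pose c := complex.Re `|X|; have cE : `|X| = (c%:C)%C by apply: realE.
have c0 : 0 <= c by have := normr_ge0 X; rewrite cE ler0c.
have k0 : 0 < 1 + c ^+ m by rewrite ltr_pwDl// exprn_ge0.
have e1 : 0 < ((e / (1 + c ^+ m))%:C)%C :> C by rewrite ltcR divr_gt0.
have /nbhs_ballP[d /= d0 Hd] := gP _ e1.
have dE : d = ((complex.Re d)%:C)%C by apply: realE; exact: ltW.
have rd0 : 0 < complex.Re d by move: d0; rewrite ltcE => /andP[].
have c1 : 0 < 1 + c by rewrite ltr_pwDl.
exists (complex.Re d / (1 + c)); first exact: divr_gt0.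
move=> s; rewrite ltr_pdivlMr// => sd.
have := Hd (A + s *: X).
have -> : A + s *: X - A = s *: X by rewrite addrAC subrr add0r.
rewrite /= (homogeneous_scale _ _ hP).
rewrite normrX normr_id normrZ cE !normcE_modulus.
rewrite -!rmorphM -!rmorphXn -!rmorphM lecR => H.
apply: le_trans (H _) _.
  rewrite -ball_normE /ball_ /= opprD addNKr normrN normrZ normcE_modulus cE -rmorphM.
  rewrite dE ltcR; apply: le_lt_trans sd; apply: ler_wpM2l; first exact: modulus_ge0.
  by rewrite lerDr.
rewrite exprMn [modulus s ^+ m * _]mulrC mulrA; apply: ler_wpM2r.
  by rewrite exprn_ge0 ?modulus_ge0.
by rewrite mulrAC ler_pdivrMr// ler_pM2l// lerDr.
Qed.

(** Subtract the two expansions along A + s X and divide by s^m: P X - s^(k-m) Q X tends to 0 with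
    s. For m < k this makes P vanish, so the case distinction settles uniqueness of the degree and
    of the polynomial together. *)
Lemma is_lowest_term_le m k g A P Q :
  (m <= k)%N -> homogeneous_poly m P -> homogeneous_poly k Q ->
  (fun X => g X - g A - P (X - A)) =o_A (fun X => `|X - A| ^+ m) ->
  (fun X => g X - g A - Q (X - A)) =o_A (fun X => `|X - A| ^+ k) ->
  forall X, P X = if (m == k) then Q X else 0.
Proof.
move=> mk hP hQ gP gQ X; apply/eqP; rewrite -subr_eq0 -modulus_eq0.
rewrite eq_le modulus_ge0 andbT; apply/ler_addgt0Pl => e e0; rewrite addr0.
have e3 : 0 < e / 4 by rewrite divr_gt0.
have [d d0 Hd] := little_direction gP hP X e3.
have [d' d'0 Hd'] := little_direction gQ hQ X e3.
pose q := modulus (Q X); have q0 : 0 < 1 + q by rewrite ltr_pwDl// modulus_ge0.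
have eq0 : 0 < e / 4 / (1 + q) by rewrite divr_gt0.
pose r := Num.min (Num.min d d') (Num.min 1 (e / 4 / (1 + q))) / 2.
have r0 : 0 < r by rewrite divr_gt0// !lt_min d0 d'0 ltr01.
have : r < r *+ 2 by rewrite mulr2n ltrDl.
rewrite {2}/r -[_ *+ 2]mulr_natr divfK ?pnatr_eq0// !lt_min.
move=> /andP[/andP[rd rd'] /andP[r1 rq]].
pose s : C := (r%:C)%C.
have ms : modulus s = r by rewrite modulus_real// ltW.
have s0 : s != 0 by rewrite -modulus_gt0 ms.
have sm0 : 0 < r ^+ m by rewrite exprn_gt0.
have D1 := Hd s; rewrite ms in D1; have {}D1 := D1 rd.
have D2 := Hd' s; rewrite ms in D2; have {}D2 := D2 rd'.
have rkm : r ^+ k <= r ^+ m by apply: ler_wiXn2l => //; exact: ltW.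
have D : modulus (P X - s ^+ (k - m) * Q X) <= e / 4 + e / 4.
  rewrite -(ler_pM2r sm0) -{1}ms -modulusX -modulusM.
  have -> : (P X - s ^+ (k - m) * Q X) * s ^+ m =
      (g (A + s *: X) - g A - s ^+ k * Q X) - (g (A + s *: X) - g A - s ^+ m * P X).
    have -> : s ^+ k = s ^+ (k - m) * s ^+ m by rewrite -exprD subnK.
    by ring.
  apply: le_trans (modulusD _ _) _; rewrite modulusN mulrDl; apply: lerD => //.
  by apply: le_trans D2 _; rewrite ler_pM2l.
case: (eqVneq m k) D => [->|nmk D].
  by rewrite subnn expr0 mul1r => D; apply: le_trans D _; clear -e0; lra.
rewrite subr0 -(subrK (s ^+ (k - m) * Q X) (P X)).
apply: le_trans (modulusD _ _) _; apply: le_trans (lerD D (lexx _)) _.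
rewrite modulusM modulusX ms.
have km : (0 < k - m)%N by rewrite subn_gt0 ltn_neqAle nmk.
have : r ^+ (k - m) * modulus (Q X) <= e / 4.
  apply: (@le_trans _ _ (r * (1 + q))); last by rewrite -ler_pdivlMr// ltW.
  apply: ler_pM; rewrite ?exprn_ge0 ?modulus_ge0 ?(ltW r0)//; last by rewrite lerDr.
  by rewrite -[leRHS]expr1; apply: ler_wiXn2l => //; exact: ltW.
by move: (r ^+ _ * _) => t; clear -e0; lra.
Qed.

Lemma is_lowest_term_uniq g A P Q :
  is_lowest_term g A P -> is_lowest_term g A Q -> P = Q.
Proof.
move=> [m [m0 hP [X PX] gP]] [k [k0 hQ [Y QY] gQ]].
have [mk|/ltnW km] := leqP m k.
  have H := is_lowest_term_le mk hP hQ gP gQ.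
  case: (eqVneq m k) H => [_ H|nmk H]; first exact/funext.
  by move: PX; rewrite H eqxx.
have H := is_lowest_term_le km hQ hP gQ gP.
case: (eqVneq k m) H => [_ H|nmk H]; first exact/esym/funext.
by move: QY; rewrite H eqxx.
Qed.

(** At [A_ t] and [A_tilde R] each [sigma j] expands exactly into a constant and two homogeneous
    terms of consecutive degrees (the second is 0 for the trace), so Q is the whole remainder. *)
Lemma lowest_term_expand m g A P Q : (0 < m)%N ->
  homogeneous_poly m P -> homogeneous_poly m.+1 Q -> (exists X, P X != 0) ->
  (forall Y, g (A + Y) = g A + P Y + Q Y) -> lowest_term g A = P.
Proof.
move=> m0 hP hQ P0 gE.
have isP : is_lowest_term g A P.
  exists m; split=> //; apply/eqoP => e e0.
  have [K [K0 QK]] := homogeneous_bound hQ.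
  have K1 : 0 < 1 + K by rewrite ltr_pwDl.
  apply/nbhs_ballP; exists (e / (1 + K)); first exact: divr_gt0.
  move=> X; rewrite -ball_normE /ball_ /= distrC ltr_pdivlMr// => XA.
  rewrite -{1}(subrKC A X) gE.
  have -> : g A + P (X - A) + Q (X - A) - g A - P (X - A) = Q (X - A) by ring.
  apply: le_trans (QK _) _; rewrite normrX normr_id exprS mulrA.
  apply: ler_wpM2r; first by rewrite exprn_ge0.
  apply: le_trans (ltW XA); rewrite mulrC; apply: ler_wpM2l => //.
  by rewrite lerDr.
have := @xgetPex _ (fun=> 0) [set P | is_lowest_term g A P] (ex_intro _ P isP).
by move=> /= H; exact: is_lowest_term_uniq H isP.
Qed.

(** [Phi 0] is the identity, and so is its differential. *)
Lemma C_prime_star A B : eigenvalue A 0 -> B \in C_prime A -> C_star A B.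
Proof.
move=> ev; rewrite inE => /(_ 0 ev) /=.
have -> : Phi (0 : C) = id :> ('M[C]_n -> 'M[C]_n).
  by apply/funext => X; rewrite /Phi conjc0 scale0r subr0 invmx1 mulmx1 raddf0 subr0.
by rewrite diff_val.
Qed.

End LowestTerm.

(** * Entire curves *)

Section Construction.
Variable R : realType.
Local Notation C := (Cplx R).
Implicit Types (A B M N : 'M[C]_3) (t l z : C).

Lemma homogeneous_s2 : homogeneous_poly 2 (@second_minors C).
Proof.
by apply: homogeneousD; [apply: homogeneousD|]; apply: homogeneousB;
  exact: homogeneous_entry2.
Qed.

Lemma homogeneous_det3 : homogeneous_poly 3 (fun X : 'M[C]_3 => \det X).
Proof.
apply: (@homogeneous_eq _ _ _ _ (fun X : 'M[C]_3 =>
  X 0 0 * X 1 1 * X 2 2 - X 0 0 * X 1 2 * X 2 1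
  - (X 0 1 * X 1 0 * X 2 2 - X 0 1 * X 1 2 * X 2 0)
  + (X 0 2 * X 1 0 * X 2 1 - X 0 2 * X 1 1 * X 2 0))).
  by move=> X; rewrite det3E; ring.
by apply: homogeneousD; [apply: homogeneousB|]; apply: homogeneousB;
  exact: homogeneous_entry3.
Qed.

Lemma lowest_term_trace A :
  lowest_term (sigma 1) A = fun X : 'M[C]_3 => X 0 0 + X 1 1 + X 2 2.
Proof.
apply: (@lowest_term_expand _ _ 1 _ _ _ (fun=> 0)) => //.
- by apply: homogeneousD; [apply: homogeneousD|]; exact: homogeneous_entry.
- exact: homogeneous0.
- by exists (delta_mx 0 0); rewrite !mxE /= !addr0 oner_eq0.
- move=> Y; have [-> _ _] := sigma3E (A + Y); have [-> _ _] := sigma3E A.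
  by rewrite !mxE; ring.
Qed.

Lemma lowest_terms_A t : t != 0 ->
  lowest_term (sigma 2) (A_ t) = (fun X : 'M[C]_3 => t * (X 0 0 + X 1 1)) /\
  lowest_term (sigma 3) (A_ t) =
    (fun X : 'M[C]_3 => t * (X 0 0 * X 1 1 - X 0 1 * X 1 0)).
Proof.
move=> t0; split.
- apply: (@lowest_term_expand _ _ 1 _ _ _ (@second_minors C)) => //.
  + by apply: homogeneousZ; apply: homogeneousD; exact: homogeneous_entry.
  + exact: homogeneous_s2.
  + by exists (delta_mx 0 0); rewrite !mxE /= !addr0 mulr1.
  + move=> Y; have [_ -> _] := sigma3E (A_ t + Y); have [_ -> _] := sigma3E (A_ t).
    by rewrite /second_minors /A_ !mxE /=; ring.
- apply: (@lowest_term_expand _ _ 2 _ _ _ (fun X : 'M[C]_3 => \det X)) => //.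
  + by apply: homogeneousZ; apply: homogeneousB; exact: homogeneous_entry2.
  + exact: homogeneous_det3.
  + by exists 1%:M; rewrite !mxE /= !mulr1n mulr0n mulr1 mulr0 subr0 mulr1.
  + move=> Y; have [_ _ ->] := sigma3E (A_ t + Y); have [_ _ ->] := sigma3E (A_ t).
    by rewrite !det3E /A_ !mxE /=; ring.
Qed.

Lemma lowest_terms_A_tilde :
  lowest_term (sigma 2) (A_tilde R) = (fun X : 'M[C]_3 => - X 2 1) /\
  lowest_term (sigma 3) (A_tilde R) =
    (fun X : 'M[C]_3 => X 0 1 * X 2 0 - X 0 0 * X 2 1).
Proof.
split.
- apply: (@lowest_term_expand _ _ 1 _ _ _ (@second_minors C)) => //.
  + apply: (@homogeneous_eq _ _ _ _ (fun X : 'M[C]_3 => -1 * X 2 1)).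
      by move=> X; rewrite mulN1r.
    by apply: homogeneousZ; exact: homogeneous_entry.
  + exact: homogeneous_s2.
  + by exists (delta_mx 2 1); rewrite !mxE /= oppr_eq0 oner_eq0.
  + move=> Y; have [_ -> _] := sigma3E (A_tilde R + Y).
    have [_ -> _] := sigma3E (A_tilde R).
    by rewrite /second_minors /A_tilde !mxE /=; ring.
- apply: (@lowest_term_expand _ _ 2 _ _ _ (fun X : 'M[C]_3 => \det X)) => //.
  + by apply: homogeneousB; exact: homogeneous_entry2.
  + exact: homogeneous_det3.
  + exists (delta_mx 0 1 + delta_mx 2 0); rewrite !mxE /=.
    by rewrite !(addr0, add0r, mulr1, mulr0, subr0) oner_eq0.
  + move=> Y; have [_ _ ->] := sigma3E (A_tilde R + Y).
    have [_ _ ->] := sigma3E (A_tilde R).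
    by rewrite !det3E /A_tilde !mxE /=; ring.
Qed.

Lemma C_prime_A t B : t != 0 -> B \in C_prime (A_ t) ->
  [/\ B 0 0 + B 1 1 = 0, B 2 2 = 0 & B 0 0 * B 1 1 = B 0 1 * B 1 0].
Proof.
move=> t0 /C_prime_star H.
have {}H : C_star (A_ t) B.
  by apply: H; rewrite eigenvalue3E det3E /second_minors /A_ !mxE /=; apply/eqP; ring.
have [E2 E3] := lowest_terms_A t0.
have := H 1 isT; rewrite lowest_term_trace => B1.
have := H 2 isT; rewrite E2 => /eqP; rewrite mulf_eq0 (negPf t0) /= => /eqP B2.
have := H 3 isT; rewrite E3 => /eqP; rewrite mulf_eq0 (negPf t0) /= subr_eq0 => /eqP B3.
by move: B1; rewrite B2 add0r => B1.
Qed.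

Lemma C_prime_A_tilde B : B \in C_prime (A_tilde R) ->
  [/\ B 0 0 + B 1 1 + B 2 2 = 0, B 2 1 = 0 & B 0 1 * B 2 0 = 0].
Proof.
move=> /C_prime_star H.
have {}H : C_star (A_tilde R) B.
  by apply: H; rewrite eigenvalue3E det3E /second_minors /A_tilde !mxE /=; apply/eqP; ring.
have [E2 E3] := lowest_terms_A_tilde.
have := H 1 isT; rewrite lowest_term_trace => B1.
have := H 2 isT; rewrite E2 => /eqP; rewrite oppr_eq0 => /eqP B2.
by have := H 3 isT; rewrite E3 B2 mulr0 subr0.
Qed.

Lemma eigenvalue_conj (P Q N : 'M[C]_3) l : P *m Q = 1%:M ->
  eigenvalue (P *m N *m Q) l -> eigenvalue N l.
Proof.
move=> PQ /eigenvalueP[v vE v0]; apply/eigenvalueP; exists (v *m P).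
  rewrite scalemxAl -vE !mulmxA -[_ *m Q *m P]mulmxA (mulmx1C PQ) mulmx1.
  by rewrite -!mulmxA.
apply: contra v0 => /eqP vP; by rewrite -[v]mulmx1 -PQ mulmxA vP mul0mx.
Qed.

Lemma derivable_mulmx (f g : C -> 'M[C]_3) z (f' g' : 'M[C]_3) :
  derivable f z 1 /\ derive1 f z = f' -> derivable g z 1 /\ derive1 g z = g' ->
  derivable (fun x => f x *m g x) z 1 /\
  derive1 (fun x => f x *m g x) z = f z *m g' + f' *m g z.
Proof.
move=> [df <-] [dg <-]; apply: entries_derivable => i j.
have -> : (fun x => (f x *m g x) i j) =
   (fun x => f x i 0 * g x 0 j + f x i 1 * g x 1 j + f x i 2 * g x 2 j).
  by apply/funext => x; rewrite mxE sum_ord3.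
have F k := derivable_entry i k df; have G k := derivable_entry k j dg.
have FG k := holoM (F k).1 (G k).1.
split; first exact: (holoD (holoD (FG 0) (FG 1)) (FG 2)).
rewrite (derive1_add (holoD (FG 0) (FG 1)) (FG 2)) (derive1_add (FG 0) (FG 1)).
rewrite (derive1_mul (F 0).1 (G 0).1) (derive1_mul (F 1).1 (G 1).1).
rewrite (derive1_mul (F 2).1 (G 2).1) (F 0).2 (F 1).2 (F 2).2 (G 0).2 (G 1).2 (G 2).2.
by rewrite !mxE !sum_ord3; ring.
Qed.

Lemma derivable_affine (A B : 'M[C]_3) z : derivable (fun x : C => A + x *: B) z 1 /\
  derive1 (fun x : C => A + x *: B) z = B.
Proof.
apply: expand_derivable => e e0; exists 1 => // z' _.
have -> : A + z' *: B - (A + z *: B) - (z' - z) *: B = 0.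
  by rewrite scalerBl opprD addrACA subrr add0r subrr.
by rewrite normr0 lecR mulr_ge0 ?modulus_ge0// ltW.
Qed.

(* Conjugating [N0 + z N1] by [(1 + z M1)(1 + z M2)], whose inverse is a
   polynomial in [z], keeps the spectrum and adds a tangent vector of the
   conjugacy class of [N0] to the derivative. *)
Lemma conj_family (N0 N1 M1 M2 : 'M[C]_3) (r : R) : r < 1 ->
  M1 *m M1 = 0 -> M2 *m M2 = 0 ->
  (forall z l, eigenvalue (N0 + z *: N1) l -> modulus l <= r) ->
  exists phi : C -> 'M[C]_3,
    [/\ holomorphic_map setT spectral_ball phi, phi 0 = N0 &
        derive1 phi 0 = N0 *m (M1 + M2) - (M1 + M2) *m N0 + N1].
Proof.
move=> r1 M11 M22 ev.
have inv (M : 'M[C]_3) z : M *m M = 0 -> (1%:M + z *: (- M)) *m (1%:M + z *: M) = 1%:M.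
  move=> MM; rewrite mulmxDl mul1mx mulmxDr mulmx1 -scalemxAl -scalemxAr mulNmx MM.
  by rewrite oppr0 !scaler0 addr0 scalerN addrK.
have dP z := derivable_mulmx (derivable_affine 1%:M (- M2) z)
  (derivable_affine 1%:M (- M1) z).
have dQ z := derivable_mulmx (derivable_affine 1%:M M1 z) (derivable_affine 1%:M M2 z).
have dphi z := derivable_mulmx (derivable_mulmx (dP z) (derivable_affine N0 N1 z)) (dQ z).
exists (fun z => (1%:M + z *: (- M2)) *m (1%:M + z *: (- M1)) *m (N0 + z *: N1) *m
   ((1%:M + z *: M1) *m (1%:M + z *: M2))); split.
- move=> z _; split; first exact: (dphi z).1.
  apply: (spectral_ball_suff r1) => l /eigenvalue_conj el.
  apply: (ev z); apply: el.
  have := inv M2 z M22; have := inv M1 z M11.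
  move: (1%:M + z *: - M1) (1%:M + z *: M1) (1%:M + z *: - M2) (1%:M + z *: M2).
  by move=> P1 Q1 P2 Q2 i1 i2; rewrite -mulmxA (mulmxA P1) i1 mul1mx i2.
- by rewrite !scale0r !addr0 !mul1mx mulmx1.
- apply: (etrans (dphi 0).2); rewrite !scale0r !addr0 !(mul1mx, mulmx1).
  rewrite mulmxDr 2!mulmxDl !mulNmx mulmxDr.
  move: (N0 *m M1) (N0 *m M2) (M1 *m N0) (M2 *m N0) => a b c d.
  by apply/matrixP => i j; rewrite !mxE; ring.
Qed.

Lemma commutator_entry N M N' i j : (N *m M - M *m N + N') i j =
  (N i 0 * M 0 j + N i 1 * M 1 j + N i 2 * M 2 j) -
  (M i 0 * N 0 j + M i 1 * N 1 j + M i 2 * N 2 j) + N' i j.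
Proof. by rewrite !mxE !sum_ord3. Qed.

(** N1 is the upper left 2x2 block of B, nilpotent by the hypotheses, so A_t + z N1 has eigenvalues
    0 and t. The commutator with A_t multiplies the two off-diagonal blocks by -t and t, which
    explains the divisions by t in M1 and M2. Each block alone has square 0, but their sum in
    general does not, hence two conjugating factors. *)
Lemma entire_disc_A t B : t != 0 -> modulus t < 1 ->
  B 0 0 + B 1 1 = 0 -> B 2 2 = 0 -> B 0 0 * B 1 1 = B 0 1 * B 1 0 ->
  exists phi : C -> 'M[C]_3,
    [/\ holomorphic_map setT spectral_ball phi, phi 0 = A_ t & derive1 phi 0 = B].
Proof.
move=> t0 t1 B1 B2 B3.
pose N1 : 'M[C]_3 := \matrix_(i, j) if (i != 2) && (j != 2) then B i j else 0.
pose M1 : 'M[C]_3 := \matrix_(i, j) if (i != 2) && (j == 2) then - (B i j / t) else 0.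
pose M2 : 'M[C]_3 := \matrix_(i, j) if (i == 2) && (j != 2) then B i j / t else 0.
have [] := @conj_family (A_ t) N1 M1 M2 _ t1.
- by apply/matrixP; apply: forall_ord3; apply: forall_ord3;
    rewrite !mxE sum_ord3 !mxE /= !(mul0r, mulr0, addr0).
- by apply/matrixP; apply: forall_ord3; apply: forall_ord3;
    rewrite !mxE sum_ord3 !mxE /= !(mul0r, mulr0, addr0).
- move=> z l; rewrite eigenvalue3E det3E /second_minors /N1 /A_ !mxE /=.
  have -> : B 1 1 = - B 0 0 by apply/eqP; rewrite -addr_eq0 addrC B1.
  have B3' : B 0 1 * B 1 0 = - (B 0 0 * B 0 0).
    by rewrite -B3 -mulrN; congr (_ * _); apply/eqP; rewrite -addr_eq0 addrC B1.
  set X := (X in X == 0).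
  have -> : X = l ^+ 2 * (l - t) - (z ^+ 2 * l - z ^+ 2 * t) *
     (B 0 1 * B 1 0 + B 0 0 * B 0 0) by rewrite /X; ring.
  rewrite B3' addNr mulr0 subr0 mulf_eq0 expf_eq0 subr_eq0 /=.
  by move=> /orP[/eqP ->|/eqP -> //]; rewrite modulus0 modulus_ge0.
- move=> phi [h0 h1 h2]; exists phi; split=> //; rewrite h2.
  apply/matrixP => i j; rewrite commutator_entry; move: i j.
  by apply: forall_ord3; apply: forall_ord3; rewrite /A_ !mxE /= ?B2; field.
Qed.

(** The parameters are the entries of N1 that commutators with A~ can correct: M1 restores b21 and
    b22, M2 restores b13, and b33 changes opposite to b22, whence the condition on [B 2 2]. The
    other equations kill every lower coefficient of the characteristic polynomial of A~ + z N1,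
    making it nilpotent for all z. *)
Lemma entire_disc_A_tilde B (n02 n10 n11 n22 : C) :
  B 2 1 = 0 -> B 2 2 = n22 - B 1 1 + n11 -> B 0 0 + n11 + n22 = 0 ->
  B 0 0 * n11 - B 0 1 * n10 + B 0 0 * n22 - n02 * B 2 0 + n11 * n22 = 0 ->
  B 0 1 * B 2 0 = 0 ->
  B 0 0 * n11 * n22 - B 0 1 * n10 * n22 - n02 * n11 * B 2 0 = 0 ->
  exists phi : C -> 'M[C]_3,
    [/\ holomorphic_map setT spectral_ball phi, phi 0 = A_tilde R &
        derive1 phi 0 = B].
Proof.
move=> B21 B22 tr0 s20 B0120 d0.
pose mx (b00 b01 b02 b10 b11 b12 b20 b21 b22 : C) : 'M[C]_3 :=
  \matrix_(i, j) (nth [::] [:: [:: b00; b01; b02]; [:: b10; b11; b12];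
    [:: b20; b21; b22]] i)`_j.
pose N1 := mx (B 0 0) (B 0 1) n02 n10 n11 (B 1 2) (B 2 0) 0 n22.
pose M1 := mx 0 0 0 0 0 0 (B 1 0 - n10) (B 1 1 - n11) 0.
pose M2 := mx 0 (n02 - B 0 2) 0 0 0 0 0 0 0.
have [] := @conj_family (A_tilde R) N1 M1 M2 0 ltr01.
- by apply/matrixP; apply: forall_ord3; apply: forall_ord3;
    rewrite !mxE sum_ord3 !mxE /= !(mul0r, mulr0, addr0).
- by apply/matrixP; apply: forall_ord3; apply: forall_ord3;
    rewrite !mxE sum_ord3 !mxE /= !(mul0r, mulr0, addr0).
- move=> z l; rewrite eigenvalue3E det3E /second_minors /N1 /A_tilde !mxE /=.
  set X := (X in X == 0).
  have -> : X = l ^+ 3 - z * (B 0 0 + n11 + n22) * l ^+ 2 + z ^+ 2 *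
     (B 0 0 * n11 - B 0 1 * n10 + B 0 0 * n22 - n02 * B 2 0 + n11 * n22) * l
     - z ^+ 3 * (B 0 0 * n11 * n22 - B 0 1 * n10 * n22 - n02 * n11 * B 2 0)
     - z ^+ 2 * (1 + z * B 1 2) * (B 0 1 * B 2 0) by rewrite /X; ring.
  rewrite tr0 s20 d0 B0120 !(mulr0, mul0r, subr0, addr0) expf_eq0 /=.
  by move=> /eqP ->; rewrite modulus0.
- move=> phi [h0 h1 h2]; exists phi; split=> //; rewrite h2.
  apply/matrixP => i j; rewrite commutator_entry; move: i j.
  by apply: forall_ord3; apply: forall_ord3;
    rewrite /A_tilde !mxE /= ?B21 ?B22; ring.
Qed.

End Construction.

(** * The dichotomy at A~ and positivity of the metric *)

Section Kobayashi.
Variable R : realType.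
Local Notation C := (Cplx R).
Implicit Types (B : 'M[C]_3) (phi : C -> 'M[C]_3).

Lemma entire_entry00_eq0 B phi : holomorphic_map setT spectral_ball phi ->
  phi 0 = A_tilde R -> derive1 phi 0 = B ->
  B 0 0 + B 1 1 + B 2 2 = 0 -> B 0 1 = 0 -> B 2 0 = 0 -> B 2 1 = 0 -> B 0 0 = 0.
Proof.
move=> hphi phi0 phi1 trB B01 B20 B21; apply/eqP; rewrite -modulus_eq0.
apply/negPn/negP => b0; have {}b0 : 0 < modulus (B 0 0).
  by rewrite lt_neqAle eq_sym b0 modulus_ge0.
(* The curve z -> phi(kz) has a corner derivative of modulus 21, above the 20 of [obstruction]. *)
pose k : R := 21 / modulus (B 0 0); have k0 : 0 <= k by rewrite divr_ge0// ltW.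
pose kc : C := (k%:C)%C.
have dk z := derivable_comp_affine (hphi (kc * z + 0) I).1.
have d0 : derive1 (fun x => phi (kc * x + 0)) 0 = kc *: B.
  by rewrite (dk 0).2 mulr0 addr0 phi1.
have := @obstruction R (fun x => phi (kc * x + 0)).
rewrite d0 mulr0 addr0 => H.
have : modulus ((kc *: B) 0 0) <= 20.
  apply: H => //; rewrite ?mxE ?B01 ?B20 ?B21 ?mulr0//.
    move=> z _; split; first exact: (dk z).1.
    exact: (hphi _ I).2.
  by rewrite -!mulrDr trB mulr0.
rewrite mxE modulusM modulus_real// /k divfK ?gt_eqF//.
by clear; lra.
Qed.

Lemma kobayashi_A_tilde_gt0 B :
  B 0 0 + B 1 1 + B 2 2 = 0 -> B 0 1 = 0 -> B 2 0 = 0 -> B 2 1 = 0 ->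
  B 0 0 != 0 -> 0 < kobayashi_royden spectral_ball (A_tilde R) B.
Proof.
move=> trB B01 B20 B21 b0; rewrite -modulus_gt0 in b0.
apply: (@lt_le_trans _ _ (modulus (B 0 0) / 20)); first exact: divr_gt0.
apply: lb_le_inf; last first.
  move=> _ [alpha [phi [hphi phi0 aB]] <-].
  have a0 : alpha != 0.
    by apply: contraTneq b0 => a0; rewrite -aB a0 scale0r mxE modulus0 ltxx.
  have Bphi i j : B i j = alpha * derive1 phi 0 i j by rewrite -aB mxE.
  have dphi i j : B i j = 0 -> derive1 phi 0 i j = 0.
    by rewrite Bphi => /eqP; rewrite mulf_eq0 (negPf a0) => /eqP.
  have H : modulus (derive1 phi 0 0 0) <= 20.
    apply: obstruction => //; try exact: dphi.
    by apply: (mulfI a0); rewrite mulr0 !mulrDr -!Bphi.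
  by rewrite ler_pdivrMr// Bphi modulusM ler_wpM2l ?modulus_ge0.
(* The infimum of an empty set would be 0, so one disc is exhibited: A~ + z delta B. As b12 = b31 =
   b32 = 0, it is triangular after reordering the basis, with eigenvalues z delta b_ii; delta = 1 /
   (2S) brings them to modulus at most 1/2. *)
pose S := 1 + modulus (B 0 0) + modulus (B 1 1) + modulus (B 2 2).
have [S0 S1 S2 S3] : [/\ 0 < S, modulus (B 0 0) <= S, modulus (B 1 1) <= S &
    modulus (B 2 2) <= S].
  have := modulus_ge0 (B 0 0); have := modulus_ge0 (B 1 1).
  by have := modulus_ge0 (B 2 2); rewrite /S; clear; move: (modulus _) (modulus _)
    (modulus _) => x y z; split; lra.
pose delta : C := ((2 * S)^-1%:C)%C.
have d0 : delta != 0 by rewrite eq_complex /= gt_eqF ?invr_gt0 ?mulr_gt0.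
have md : modulus delta = (2 * S)^-1 by rewrite modulus_real// invr_ge0 mulr_ge0// ltW.
exists (modulus delta^-1), delta^-1 => //.
have dA z := derivable_affine (A_tilde R) (delta *: B) z.
exists (fun z => A_tilde R + z *: (delta *: B)); split.
- move=> z /disc_modulus z1; split; first exact: (dA z).1.
  apply: (@spectral_ball_suff _ _ _ 2^-1); first by clear; lra.
  move=> l; rewrite eigenvalue3E det3E /second_minors /A_tilde !mxE /= B01 B20 B21.
  set X := (X in X == 0).
  have -> : X = (l - z * (delta * B 0 0)) * ((l - z * (delta * B 1 1)) *
     (l - z * (delta * B 2 2))) by rewrite /X; ring.
  have small b : modulus b <= S -> modulus (z * (delta * b)) <= 2^-1.
    move=> bS; rewrite !modulusM md.
    apply: (@le_trans _ _ ((2 * S)^-1 * modulus b)).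
      apply: ler_piMl; last exact: ltW.
      by apply: mulr_ge0; rewrite ?modulus_ge0// -md modulus_ge0.
    by rewrite invfM -mulrA ler_piMr ?invr_ge0// mulrC ler_pdivrMr// mul1r.
  rewrite !mulf_eq0 !subr_eq0 => /or3P[] /eqP ->; exact: small.
- by rewrite scale0r addr0.
- by rewrite (dA 0).2 scalerA mulVf// scale1r.
Qed.

(** If b11 = 0, all parameters can be 0. Otherwise exactly one of b12, b31 is nonzero; the opposite
    entry of N1 is free, and setting it to -b11^2 divided by that number makes a 2x2 block with
    diagonal b11, -b11 nilpotent. *)
Lemma entire_disc_A_tildeP B : B 0 0 + B 1 1 + B 2 2 = 0 -> B 2 1 = 0 ->
  B 0 1 * B 2 0 = 0 -> B 0 0 = 0 \/ B 0 1 <> B 2 0 ->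
  exists phi : C -> 'M[C]_3,
    [/\ holomorphic_map setT spectral_ball phi, phi 0 = A_tilde R &
        derive1 phi 0 = B].
Proof.
move=> trB B21 B0120 cond.
have B22 : B 2 2 = - B 0 0 - B 1 1.
  by apply/eqP; rewrite -subr_eq0 -trB; apply/eqP; ring.
have [B00|nB00] := eqVneq (B 0 0) 0.
  by apply: (@entire_disc_A_tilde _ _ 0 0 0 0);
    rewrite // ?B22 ?B00 ?B0120; ring.
have [B01|nB01] := eqVneq (B 0 1) 0.
  have nB20 : B 2 0 != 0.
    by case: cond => [E|]; [rewrite E eqxx in nB00|rewrite B01 => /nesym/eqP].
  by apply: (@entire_disc_A_tilde _ _ (- (B 0 0 ^+ 2 / B 2 0)) 0 0 (- B 0 0));
    rewrite // ?B22 ?B01; field.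
have B20 : B 2 0 = 0.
  by move/eqP: B0120; rewrite mulf_eq0 (negPf nB01) => /eqP.
by apply: (@entire_disc_A_tilde _ _ 0 (- (B 0 0 ^+ 2 / B 0 1)) (- B 0 0) 0);
  rewrite // ?B22 ?B20; field.
Qed.

End Kobayashi.

Theorem proposition6 (R : realType) :
  (forall (t : Cplx R) (B : 'M[Cplx R]_3),
     t \in disc `\ 0 -> B \in C_prime (A_ t) ->
     exists phi : Cplx R -> 'M[Cplx R]_3,
       [/\ holomorphic_map setT spectral_ball phi,
           phi 0 = A_ t & derive1 phi 0 = B]) /\
  (forall B : 'M[Cplx R]_3,
     B \in C_prime (A_tilde R) ->
     ((exists phi : Cplx R -> 'M[Cplx R]_3,
         [/\ holomorphic_map setT spectral_ball phi,
             phi 0 = A_tilde R & derive1 phi 0 = B])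
        <-> (B 0 0 = 0 \/ B 0 1 <> B 2 0)) /\
     (~ (B 0 0 = 0 \/ B 0 1 <> B 2 0) ->
        0 < kobayashi_royden spectral_ball (A_tilde R) B)).
Proof.
split=> [t B|B /C_prime_A_tilde[trB B21 B0120]].
  rewrite inE => -[/disc_modulus t1 t0] Bt; have {}t0 : t != 0 by apply/eqP.
  by have [B1 B2 B3] := C_prime_A t0 Bt; exact: entire_disc_A.
have zeros : ~ (B 0 0 = 0 \/ B 0 1 <> B 2 0) ->
    [/\ B 0 0 != 0, B 0 1 = 0 & B 2 0 = 0].
  move=> /not_orP[/eqP b00 /contrapT bE].
  by move: B0120; rewrite bE => /eqP; rewrite mulf_eq0 orbb => /eqP b20.
split; last by move=> /zeros[b00 b01 b20]; exact: kobayashi_A_tilde_gt0.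
split=> [[phi [hphi phi0 phi1]]|]; last exact: entire_disc_A_tildeP.
apply: contrapT => /zeros[/eqP b00 b01 b20].
exact/b00/(entire_entry00_eq0 hphi phi0 phi1).
Qed.
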